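(* Let $b\ge2$ be a fixed integer and set $\lambda=\lambda(n)=n\log b+f(n)>0$. Then, as $n\to\infty$: (1) $G_n(\lambda)$ has isolated vertices with high probability if $f(n)\to-\infty$; (2) $G_n(\lambda)$ has isolated vertices with probability bounded away from $0$ and $1$ if $f(n)=O(1)$ (i.e. $|f(n)|$ is bounded); (3) whereas if $f(n)\geq\alpha\log n$, then $G_n(\lambda)$ is connected with high probability.
   Context: $\log$ is the natural logarithm; ''with high probability'' means with probability tending to $1$ as $n\to\infty$. In (3), $\alpha$ is a constant (not depending on $n$) whose admissible range the source's statement does not specify; the source's proof of (3) uses the inequality $\alpha>b-1$. $T_n$ is the complete $b$-ary tree of height $n$ ($T_0$ is a single vertex; $T_{h+1}$ is obtained from $b$ disjoint copies of $T_h$ by adding a new vertex, the apex, joined to the apex of each copy), with set of leaves $L_n$, $|L_n|=b^n$. Poisson edge model $G_n(\lambda)$: the random multigraph with vertex set $L_n$ in which, independently for each unordered pair of distinct leaves $x,y\in L_n$, the number of $x$–$y$ edges has the Poisson distribution with mean $\lambda b^{1-d(x,y)}$, where $d(x,y)$ is the graph distance between $x$ and $y$ in $T_n$. *)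

(* Defs.v *)
(* Written over MathComp and MathComp-Analysis. *)
From HB Require Import structures.
From mathcomp Require Import all_boot all_order all_algebra.
From mathcomp Require Import all_classical all_reals all_analysis.
Import Order.TTheory GRing.Theory Num.Theory.
Import numFieldNormedType.Exports.

Set Implicit Arguments.
Unset Strict Implicit.
Unset Printing Implicit Defensive.

Local Open Scope classical_set_scope.
Local Open Scope ring_scope.

(* In [tree_vertex b h.+1], [None] is the new apex and [Some (i, v)] is the
   vertex [v] in the [i]-th copy of the tree of height [h]. *)
Fixpoint tree_vertex (b n : nat) : finType :=
  match n with
  | 0 => unit
  | h.+1 => option ('I_b * tree_vertex b h)%type
  end.

Definition apex (b n : nat) : tree_vertex b n :=
  match n return tree_vertex b n with
  | 0 => tt
  | _.+1 => None
  end.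

Fixpoint tree_adj (b n : nat) : rel (tree_vertex b n) :=
  match n return rel (tree_vertex b n) with
  | 0 => fun _ _ => false
  | h.+1 => fun u v =>
      match u, v with
      | Some (i, u'), Some (j, v') => (i == j) && @tree_adj b h u' v'
      | None, Some (_, w) | Some (_, w), None => w == apex b h
      | None, None => false
      end
  end.

Fixpoint is_leaf (b n : nat) : pred (tree_vertex b n) :=
  match n return pred (tree_vertex b n) with
  | 0 => fun _ => true
  | h.+1 => fun u => if u is Some (_, u') then @is_leaf b h u' else false
  end.

Definition leaf (b n : nat) : finType := {v : tree_vertex b n | is_leaf v}.

Lemma card_leaf (b n : nat) : #|leaf b n| = (b ^ n)%N.
Proof.
rewrite card_sig; elim: n => [|h IH] /=.
  by rewrite -[RHS]card_unit; apply: fintype.eq_card => -[].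
rewrite expnS -IH.
have -> : (b * #|[pred v | @is_leaf b h v]|)%N =
    #|[predX 'I_b & [pred v | @is_leaf b h v]]|.
  by rewrite cardX card_ord.
rewrite -[RHS](fintype.card_image (f := Some)); last by move=> ? ? [].
apply: fintype.eq_card => -[[i v]|]; last by apply/esym/negP => /fintype.imageP[].
by rewrite fintype.mem_image // => ? ? [].
Qed.

(* A shortest walk has fewer than [#|V|] edges; the value is [#|V|] when [y]
   cannot be reached from [x], which does not happen in a tree. *)
Definition graph_dist (V : finType) (e : rel V) (x y : V) : nat :=
  \big[minn/#|V|]_(k < #|V| |
      [exists p : k.-tuple V, path e x p && (last x p == y)]) k.

Definition leaf_dist (b n : nat) (x y : leaf b n) : nat :=
  graph_dist (@tree_adj b n) (val x) (val y).

(* Unordered pairs of distinct elements. *)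
Definition upair (V : finType) : finType := {e : {set V} | #|e| == 2}.

(* A loopless multigraph is given by its edge multiplicities. *)
Definition multigraph (V : finType) : Type := upair V -> nat.

Definition mg_adj (V : finType) (G : multigraph V) : rel V :=
  fun x y => [exists e : upair V, (val e == [set x; y]%SET) && (0 < G e)%N].

Definition has_isolated_vertex (V : finType) (G : multigraph V) : bool :=
  [exists x, forall y, ~~ mg_adj G x y].

Definition mg_connected (V : finType) (G : multigraph V) : bool :=
  [forall x, forall y, connect (mg_adj G) x y].

Definition mutually_independent (R : realType) (d d' : measure_display)
    (T : measurableType d) (T' : measurableType d') (P : probability T R)
    (I : finType) (X : I -> {RV P >-> T'}) : Prop :=
  forall (J : {set I}) (B : I -> set T'), (forall i, measurable (B i)) ->
    P (\bigcap_(i in [set` J]) (X i @^-1` B i)) =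
    (\prod_(i in J) P (X i @^-1` B i))%E.

Definition random_multigraph (R : realType) (d : measure_display)
    (T : measurableType d) (P : probability T R) (V : finType)
    (N : upair V -> {RV P >-> nat}) (w : T) : multigraph V :=
  fun e => N e w.

Definition poisson_edge_model (R : realType) (b n : nat) (lambda : R)
    (d : measure_display) (T : measurableType d) (P : probability T R)
    (N : upair (leaf b n) -> {RV P >-> nat}) : Prop :=
  mutually_independent N /\
  forall (e : upair (leaf b n)) (x y : leaf b n), val e = [set x; y]%SET ->
    forall k : nat, distribution P (N e) [set k] =
      (poisson_pmf (lambda * b%:R ^ (1 - (leaf_dist x y)%:Z)) k)%:E.

(* Main.v *)
(* For a set [A] of leaves of a subtree of height [h], let [cut A] be the sum of
   [b^(1-d(x,y))] over [x] in [A], [y] outside [A], so that no edge leaves [A]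
   with probability [exp (- lambda cut A)], and let [a] be the density of [A].

   Isolated vertices: a singleton has [cut = 1 - b^-n], so a vertex is isolated
   with probability about [b^-n exp (-f)].  The second moment method bounds the
   probability of an isolated vertex from below.  Conversely, given that [x] is
   isolated, the other vertices can only use the edges not at [x]; so the events
   of not being isolated are positively correlated, and with probability at
   least [(1 - P(x isolated))^(b^n)] they all occur.

   Connectivity: it suffices that the defect [D_h(t)], the sum of
   [exp (- lambda (cut A + t a))] over nonempty [A] with [a <= 1/2], tends to
   [0] at [h = n], [t = 0].  With [a_i] the densities of [A] in the [b] subtrees,
     [cut A = sum_i cut A_i + (1/b) sum_(i <> j) a_i (1 - a_j)].
   If every [a_i <= 1/2], one nonempty [A_i] carries the slope
   [t' = 1 - (1 - t)/b], and the others together cost a factor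
   [(1 + D_h(0))^(b-1)].  Otherwise some subtrees are mostly inside [A] and some
   mostly outside; replacing each [A_i] by its minority side gives a factor
   [exp (- lambda (1 - (1 - t)/b))].  Hence, up to constants,
     [D_(h+1)(t) <= b D_h(t') + exp (- lambda (1 - (1 - t)/b))],
   whose solution at [h = n], [t = 0] is of order [exp (- f/2)]. *)
Require Import Defs.
From mathcomp Require Import all_boot all_order all_algebra.
From mathcomp Require Import all_classical all_reals all_analysis.
From mathcomp Require Import zify ring lra.
Import Order.TTheory GRing.Theory Num.Theory.
Import numFieldNormedType.Exports.

Set Implicit Arguments.
Unset Strict Implicit.
Unset Printing Implicit Defensive.

(** * Distances between leaves *)

Section TreeDistance.
Local Open Scope nat_scope.

Lemma bigminn_le (m n : nat) (P : pred 'I_n) (i : 'I_n) :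
  P i -> \big[minn/m]_(k < n | P k) k <= i.
Proof.
move=> Pi; have := mem_index_enum i.
elim: (index_enum _) => // k s IH; rewrite in_cons big_cons.
case/orP => [/eqP <-|/IH le]; first by rewrite Pi geq_minl.
by case: ifP => // _; rewrite geq_min le orbT.
Qed.

Fixpoint tree_depth (b n : nat) : tree_vertex b n -> nat :=
  match n return tree_vertex b n -> nat with
  | 0 => fun _ => 0
  | h.+1 => fun u => if u is Some (_, u') then (@tree_depth b h u').+1 else 0
  end.

(** Closed form of the graph distance: a walk between different copies must pass through the apex,
    so the two depths add up. *)
Fixpoint tree_dist (b n : nat) : tree_vertex b n -> tree_vertex b n -> nat :=
  match n return tree_vertex b n -> tree_vertex b n -> nat with
  | 0 => fun _ _ => 0
  | h.+1 => fun u v =>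
      match u, v with
      | Some (i, u'), Some (j, v') =>
          if i == j then @tree_dist b h u' v'
          else (tree_depth u').+1 + (tree_depth v').+1
      | None, Some (_, w) | Some (_, w), None => (tree_depth w).+1
      | None, None => 0
      end
  end.

Lemma tree_depth_apex b n : tree_depth (apex b n) = 0.
Proof. by case: n. Qed.

Lemma tree_dist_apex b n (u : tree_vertex b n) :
  tree_dist u (apex b n) = tree_depth u.
Proof. by case: n u => [|n] //= [[i u]|]. Qed.

Lemma tree_dist0 b n (u : tree_vertex b n) : tree_dist u u = 0.
Proof. by elim: n u => [|n IH] //= [[i u]|] //; rewrite eqxx. Qed.

Lemma tree_adj_sym b n : symmetric (@tree_adj b n).
Proof.
elim: n => [|n IH] //= [[i u]|] [[j v]|] //=.
by rewrite IH eq_sym.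
Qed.

Lemma tree_depth_adj b n (u v : tree_vertex b n) :
  tree_adj u v -> tree_depth v <= (tree_depth u).+1.
Proof.
elim: n u v => [|n IH] //= [[i u]|] [[j v]|] //=.
- by case/andP => _ /IH.
- by move/eqP => ->; rewrite tree_depth_apex.
Qed.

(** Being 1-Lipschitz along edges, [tree_dist] bounds the length of every walk from below. *)
Lemma tree_dist_adj b n (u v w : tree_vertex b n) :
  tree_adj v w -> tree_dist u w <= (tree_dist u v).+1.
Proof.
elim: n u v w => [|n IH] //= [[i u]|] [[j v]|] [[k w]|] //=.
- case/andP => /eqP <- vw; case: ifP => _; first exact: IH.
  by have := tree_depth_adj vw; lia.
- move=> /eqP ->; rewrite tree_dist_apex tree_depth_apex.
  by case: ifP; lia.
- move=> /eqP ->; rewrite tree_dist_apex tree_depth_apex.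
  by case: ifP; lia.
- by case/andP => _ /tree_depth_adj.
- by move=> /eqP ->; rewrite tree_depth_apex.
Qed.

Lemma tree_dist_path b n (u v : tree_vertex b n) p :
  path (@tree_adj b n) v p -> tree_dist u (last v p) <= tree_dist u v + size p.
Proof.
elim: p v => [|w p IH] v /=; first by rewrite addn0.
by case/andP => /(@tree_dist_adj _ _ u) vw /IH; lia.
Qed.

Lemma tree_path_apex b n (u : tree_vertex b n) : exists p,
  [/\ path (@tree_adj b n) (apex b n) p, last (apex b n) p = u &
      size p = tree_depth u].
Proof.
elim: n u => [|n IH] /= u; first by exists [::]; case: u.
case: u => [[i u]|]; last by exists [::].
have [p [pp lp sp]] := IH u.
exists (map (fun w => Some (i, w)) (apex b n :: p)).
rewrite /= eqxx last_map size_map lp sp; split=> //.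
apply: (homo_path (e := @tree_adj b n)) pp => x y xy.
by rewrite eqxx.
Qed.

Lemma tree_path_rev b n (u v : tree_vertex b n) p :
  path (@tree_adj b n) u p -> last u p = v -> exists q,
  [/\ path (@tree_adj b n) v q, last v q = u & size q = size p].
Proof.
move=> pp <-; exists (rev (belast u p)); rewrite rev_path size_rev size_belast.
split=> //.
  by rewrite (eq_path (e' := @tree_adj b n)) // => x y; exact: tree_adj_sym.
by case: p pp => //= w p _; rewrite rev_cons last_rcons.
Qed.

Lemma tree_dist_witness b n (u v : tree_vertex b n) : exists p,
  [/\ path (@tree_adj b n) u p, last u p = v & size p = tree_dist u v].
Proof.
elim: n u v => [|n IH]; first by exists [::]; case: u v => [] [].
move=> u v; have [/= p [pp lp sp]] := tree_path_apex u.
have [/= q [pq lq sq]] := tree_path_apex v.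
have [/= p' [pp' lp' sp']] := @tree_path_rev b n.+1 _ _ _ pp lp.
rewrite sp in sp'; clear p pp lp sp.
case: u v pp' lp' sp' pq lq sq
  => [[i u]|] [[j v]|] pp' lp' sp' pq lq sq.
- have [ij|ij] := eqVneq i j; last first.
    exists (p' ++ q); rewrite cat_path last_cat size_cat lp' pp' pq.
    by rewrite sp' sq.
  have [s [ps ls ss]] := IH u v.
  exists (map (fun w => Some (i, w)) s).
  rewrite last_map size_map ls ss ij; split=> //.
  apply: (homo_path (e := @tree_adj b n)) ps => x y xy /=.
  by rewrite eqxx.
- by exists p'; rewrite sp'.
- by exists q.
- by exists [::].
Qed.

Lemma graph_dist_tree b n (u v : tree_vertex b n) :
  graph_dist (@tree_adj b n) u v = tree_dist u v.
Proof.
have lower p : path (@tree_adj b n) u p -> last u p = v ->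
    tree_dist u v <= size p.
  by move=> /(@tree_dist_path _ _ u) + <-; rewrite tree_dist0.
have [p [pp lp sp]] := tree_dist_witness u v.
(* The minimum in [graph_dist] only sees lengths below the number of vertices, so the witness must
   be a walk without repetition. *)
have [p' [pp' lp' up' sp']] : exists p', [/\ path (@tree_adj b n) u p',
    last u p' = v, uniq (u :: p') & size p' = tree_dist u v].
  case: (shortenP pp) lp => p' pp' up' sub lp.
  exists p'; split=> //; apply/eqP; rewrite eqn_leq lower // andbT -sp.
  by apply: uniq_leq_size sub; case/andP: up'.
have lt : tree_dist u v < #|tree_vertex b n|.
  by rewrite -sp'; move/card_uniqP: up' => /= <-; exact: max_card.
apply/eqP; rewrite eqn_leq; apply/andP; split.
  have sz : size p' == tree_dist u v by apply/eqP.
  apply: (@bigminn_le _ _ _ (Ordinal lt)).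
  by apply/existsP; exists (Tuple sz); rewrite /= pp' lp' eqxx.
(* The default value of the minimum is also at least the distance, by [lt]. *)
rewrite /graph_dist; elim/big_ind: _ => [|x y hx hy|k].
- exact: ltnW.
- by rewrite leq_min hx.
- by case/existsP => q /andP[pq /eqP lq]; rewrite -(size_tuple q); exact: lower.
Qed.

Lemma tree_depth_leaf b n (u : tree_vertex b n) : is_leaf u -> tree_depth u = n.
Proof. by elim: n u => [|n IH] //= [[i u]|] // /IH ->. Qed.

End TreeDistance.

Local Open Scope ring_scope.

(** * Decomposition of leaves and leaf sets along the children of the apex *)

Definition leaf_cons b h (i : 'I_b) (x : leaf b h) : leaf b h.+1 :=
  exist (fun v : tree_vertex b h.+1 => is_leaf v) (Some (i, val x)) (valP x).

Lemma leaf_cons_bij b h :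
  bijective (fun p : 'I_b * leaf b h => leaf_cons p.1 p.2).
Proof.
apply: inj_card_bij => [[i x] [j y] /(congr1 val) /= [-> /val_inj ->] //|].
by rewrite card_prod card_ord !card_leaf expnS.
Qed.

Lemma big_leaf_cons (T : Type) (idx : T) (op : Monoid.com_law idx) b h
    (F : leaf b h.+1 -> T) :
  \big[op/idx]_v F v = \big[op/idx]_(i < b) \big[op/idx]_x F (leaf_cons i x).
Proof.
rewrite (reindex (fun p : 'I_b * leaf b h => leaf_cons p.1 p.2)) /=.
  by rewrite pair_bigA.
exact/onW_bij/leaf_cons_bij.
Qed.

Lemma leaf_dist_cons b h (i j : 'I_b) (x y : leaf b h) :
  leaf_dist (leaf_cons i x) (leaf_cons j y) =
  if i == j then leaf_dist x y else (2 * h.+1)%N.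
Proof.
rewrite /leaf_dist !graph_dist_tree /=; case: ifP => // _.
by rewrite !tree_depth_leaf ?(valP x) ?(valP y) // addnn mul2n.
Qed.

Lemma leaf0_eq b (x y : leaf b 0) : x = y.
Proof. by apply: val_inj; case: (val x) (val y) => -[]. Qed.

Lemma leaf_dist_sym b h (x y : leaf b h) : leaf_dist x y = leaf_dist y x.
Proof.
elim: h x y => [|h IH] x y; first by rewrite (leaf0_eq x y).
have [g _ gK] := leaf_cons_bij b h.
rewrite -(gK x) -(gK y) !leaf_dist_cons eq_sym; case: ifP => // _; exact: IH.
Qed.

Definition slice b h (A : {set leaf b h.+1}) (i : 'I_b) : {set leaf b h} :=
  [set x | leaf_cons i x \in A].

Definition slices b h (A : {set leaf b h.+1}) : {ffun 'I_b -> {set leaf b h}} :=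
  [ffun i => slice A i].

(** This turns a sum over leaf sets into a sum over families of leaf sets of the children, where
    products factor. *)
Lemma slices_bij b h : bijective (@slices b h).
Proof.
apply: inj_card_bij => [A B AB|].
  have [g _ gK] := leaf_cons_bij b h.
  apply/setP => v; rewrite -(gK v).
  have /ffunP/(_ (g v).1) := AB; rewrite !ffunE => /setP/(_ (g v).2).
  by rewrite !inE.
rewrite card_ffun card_ord -!cardsT -!powersetT !card_powerset !cardsT !card_leaf.
by rewrite -expnM expnSr.
Qed.

(** * Cuts *)

Section Energy.
Variables (R : realType) (b : nat).

Definition rate h (x y : leaf b h) : R := b%:R ^ (1 - (leaf_dist x y)%:Z).

Definition cut_rate h (A : {set leaf b h}) : R :=
  \sum_(x in A) \sum_(y in ~: A) rate x y.

Definition density h (A : {set leaf b h}) : R := #|A|%:R / b%:R ^+ h.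

Hypothesis b_gt0 : (0 < b)%N.

Lemma rate_sym h (x y : leaf b h) : rate x y = rate y x.
Proof. by rewrite /rate leaf_dist_sym. Qed.

Lemma rate_ge0 h (x y : leaf b h) : 0 <= rate x y.
Proof. exact: exprz_ge0. Qed.

(** Leaves of different children are at distance [2 (h + 1)]. The power is split so that each factor
    [b^-h] turns a count in a child into a density. *)
Lemma rate_cons h (i j : 'I_b) (x y : leaf b h) :
  rate (leaf_cons i x) (leaf_cons j y) =
  if i == j then rate x y else b%:R^-1 * (b%:R ^- h * b%:R ^- h).
Proof.
rewrite /rate leaf_dist_cons; case: ifP => // _.
have -> : 1 - (2 * h.+1)%:Z = - (h + h).+1%:Z by lia.
have XN : (b%:R : R) ^ Negz (h + h) = b%:R ^- (h + h).+1 by [].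
by rewrite -NegzE XN exprS exprD !invfM.
Qed.

Lemma cut_rateC h (A : {set leaf b h}) : cut_rate (~: A) = cut_rate A.
Proof.
rewrite /cut_rate exchange_big finset.setCK; apply: eq_bigr => x _; apply: eq_bigr => y _.
exact: rate_sym.
Qed.

Lemma cut_rate0 h : cut_rate (finset.set0 : {set leaf b h}) = 0.
Proof. by rewrite /cut_rate big_set0. Qed.

Lemma density0 h : density (finset.set0 : {set leaf b h}) = 0.
Proof. by rewrite /density cards0 mul0r. Qed.

Lemma density_ge0 h (A : {set leaf b h}) : 0 <= density A.
Proof. by rewrite divr_ge0 // exprn_ge0. Qed.

Lemma bX_gt0 h : 0 < (b%:R : R) ^+ h.
Proof. by rewrite exprn_gt0 // ltr0n. Qed.

Lemma densityC h (A : {set leaf b h}) : density (~: A) = 1 - density A.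
Proof.
apply/eqP; rewrite eq_sym subr_eq /density -mulrDl -natrD addnC cardsC.
by rewrite card_leaf natrX divff // lt0r_neq0 ?bX_gt0.
Qed.

Lemma density_le12 h (A : {set leaf b h}) :
  (density A <= 1 / 2%:R) = (2 * #|A| <= b ^ h)%N.
Proof.
rewrite /density ler_pdivrMr ?bX_gt0 // -natrX -(ler_nat R) natrM.
by apply/idP/idP => ?; lra.
Qed.

Lemma density_slices h (A : {set leaf b h.+1}) :
  density A = b%:R^-1 * \sum_(i < b) density (slice A i).
Proof.
rewrite /density -mulr_suml exprS invfM mulrCA; congr (_ * (_ / _)).
rewrite -natr_sum; congr (_%:R).
rewrite -sum1_card big_mkcond big_leaf_cons; apply: eq_bigr => i _.
by rewrite -big_mkcond /= -sum1_card; apply: eq_bigl => x; rewrite inE.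
Qed.

(* The two orders of an unordered pair of children are added up. *)
Definition mix (u v : R) := u * (1 - v) + v * (1 - u).

(** Pairs within a child give the cut of its slice; pairs across children depend only on the
    densities. The extra [2] in the denominator offsets the two orders counted by [mix]. *)
Lemma cut_rate_slices h (A : {set leaf b h.+1}) :
  cut_rate A = \sum_(i < b) cut_rate (slice A i) +
    (2%:R * b%:R)^-1 * \sum_(i < b) \sum_(j < b | j != i)
      mix (density (slice A i)) (density (slice A j)).
Proof.
have -> : \sum_(i < b) \sum_(j < b | j != i)
      mix (density (slice A i)) (density (slice A j)) =
    2%:R * \sum_(i < b) \sum_(j < b | j != i)
      density (slice A i) * density (~: slice A j).
  rewrite mulr2n mulrDl mul1r [X in _ = _ + X](exchange_big_dep predT) //=.
  rewrite -big_split; apply: eq_bigr => i _.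
  under [X in _ = _ + X]eq_bigl do rewrite eq_sym.
  by rewrite -big_split; apply: eq_bigr => j _; rewrite !densityC /mix /=; ring.
rewrite invfM mulrACA mulVf ?mul1r ?pnatr_eq0 //.
rewrite mulr_sumr -big_split /= /cut_rate big_mkcond big_leaf_cons.
apply: eq_bigr => i _; rewrite -big_mkcond /=.
rewrite (eq_bigl (fun x => x \in slice A i)); last by move=> x; rewrite inE.
have inner x : \sum_(y in ~: A) rate (leaf_cons i x) y =
    \sum_(y in ~: slice A i) rate x y +
    \sum_(j < b | j != i) b%:R^-1 * (b%:R ^- h * density (~: slice A j)).
  rewrite big_mkcond big_leaf_cons (bigD1 i) //=; congr (_ + _).
    rewrite -big_mkcond; apply: eq_big => [y|y _]; first by rewrite !inE.
    by rewrite rate_cons eqxx.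
  apply: eq_bigr => j ji; rewrite -big_mkcond.
  rewrite (eq_bigr (fun _ => b%:R^-1 * (b%:R ^- h * b%:R ^- h))); last first.
    by move=> y _; rewrite rate_cons eq_sym (negbTE ji).
  rewrite (eq_bigl (fun y => y \in ~: slice A j)); last by move=> y; rewrite !inE.
  by rewrite sumr_const /density -[LHS]mulr_natr; ring.
rewrite (eq_bigr _ (fun x _ => inner x)) big_split sumr_const; congr (_ + _).
rewrite -[LHS]mulr_natr mulr_suml mulr_sumr; apply: eq_bigr => j _.
by rewrite /density; ring.
Qed.

End Energy.

Arguments rate R {b h} x y.
Arguments cut_rate R {b h} A.
Arguments density R {b h} A.

(** * The defect recursion *)

Section Recursion.
Variables (R : realType) (b : nat) (lam : R).
Hypotheses (b_ge2 : (2 <= b)%N) (lam_gt0 : 0 < lam).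
Let b_gt0 : (0 < b)%N := ltnW b_ge2.
Let bR2 : 2%:R <= b%:R :> R. Proof. by rewrite ler_nat. Qed.
Let bR0 : 0 < b%:R :> R. Proof. by rewrite ltr0n. Qed.
Let bRn0 : b%:R != 0 :> R. Proof. by rewrite lt0r_neq0. Qed.

Let bR1 : b.-1%:R = b%:R - 1 :> R. Proof. by rewrite -subn1 natrB. Qed.

(** At [t = 0] this is the probability that no edge leaves [A]. The slope [t] carries the density
    terms that the recursion passes down to the children. *)
Definition weight h (t : R) (A : {set leaf b h}) : R :=
  expR (- (lam * (cut_rate R A + t * density R A))).

Definition small h (A : {set leaf b h}) : bool := (2 * #|A| <= b ^ h)%N.

Definition minority h (A : {set leaf b h}) : {set leaf b h} :=
  if small A then A else ~: A.

Definition defect h (t : R) : R :=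
  \sum_(A : {set leaf b h} | (A != finset.set0) && small A) weight t A.

Lemma weight_ge0 h t (A : {set leaf b h}) : 0 <= weight t A.
Proof. exact: expR_ge0. Qed.

Lemma defect_ge0 h t : 0 <= defect h t.
Proof. by apply: sumr_ge0 => A _; exact: weight_ge0. Qed.

Lemma weight_le h s t (A : {set leaf b h}) : s <= t -> weight t A <= weight s A.
Proof.
move=> st; rewrite ler_expR lerN2 ler_pM2l // lerD2l ler_wpM2r //.
exact: density_ge0.
Qed.

Lemma defect_le h s t : s <= t -> defect h t <= defect h s.
Proof. by move=> st; apply: ler_sum => A _; exact: weight_le. Qed.

Lemma small0 h : small (finset.set0 : {set leaf b h}).
Proof. by rewrite /small cards0. Qed.

Lemma smallC h (A : {set leaf b h}) : ~~ small A -> small (~: A).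
Proof.
rewrite /small -card_leaf; have := cardsC A; rewrite cardsE; lia.
Qed.

Lemma small_minority h (A : {set leaf b h}) : small (minority A).
Proof. by rewrite /minority; case: ifP => // /negbT/smallC. Qed.

Lemma cut_rate_minority h (A : {set leaf b h}) : cut_rate R (minority A) = cut_rate R A.
Proof. by rewrite /minority; case: ifP => // _; rewrite cut_rateC. Qed.

Lemma density_minority h (A : {set leaf b h}) :
  density R A = if small A then density R (minority A)
                else 1 - density R (minority A).
Proof. by rewrite /minority; case: (small A) => //; rewrite densityC // subKr. Qed.

Lemma density_small h (A : {set leaf b h}) : small A -> density R A <= 1 / 2%:R.
Proof. by rewrite density_le12. Qed.

Lemma sum_small h t :
  \sum_(A : {set leaf b h} | small A) weight t A = 1 + defect h t.
Proof.
rewrite (bigD1 finset.set0) ?small0 //= /weight cut_rate0 density0 mulr0 addr0 mulr0.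
by rewrite oppr0 expR0; congr (_ + _); apply: eq_bigl => A; rewrite andbC.
Qed.

(** A small set is the minority side of at most two sets, itself and its complement. *)
Lemma sum_minority h t :
  \sum_(A : {set leaf b h}) weight t (minority A) <= 2%:R * (1 + defect h t).
Proof.
rewrite (bigID (@small h)) /= mulr2n mulrDl mul1r -sum_small; apply: lerD.
  by rewrite le_eqVlt; apply/orP/or_introl/eqP/eq_bigr => A; rewrite /minority => ->.
rewrite (reindex_inj (inv_inj (@finset.setCK _))) /=.
rewrite [leRHS]big_mkcond [leLHS]big_mkcond /=; apply: ler_sum => A _.
case: ifPn => [sA|_]; last by case: ifP; rewrite ?weight_ge0.
rewrite /minority (negbTE sA) finset.setCK.
by move: (smallC sA); rewrite finset.setCK => ->.
Qed.

(** For [u, v] in [[0, 1/2]], [mix u v - u = v (1 - 2 u) >= 0]. The [b - 1] pairs containing [i0],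
    each in both orders, already give the bound. *)
Lemma sum_mix_ge (u : 'I_b -> R) (i0 : 'I_b) :
  (forall i, 0 <= u i <= 1 / 2%:R) ->
  2%:R * (b%:R - 1) * u i0 <=
  \sum_(i < b) \sum_(j < b | j != i) mix (u i) (u j).
Proof.
move=> u01.
have mix0 i j : 0 <= mix (u i) (u j).
  by have := u01 i; have := u01 j; rewrite /mix => /andP[? ?] /andP[? ?]; nra.
have mixi j : u i0 <= mix (u i0) (u j) /\ u i0 <= mix (u j) (u i0).
  by have := u01 i0; have := u01 j; rewrite /mix => /andP[? ?] /andP[? ?]; split; nra.
have cst : \sum_(j < b | j != i0) u i0 = (b%:R - 1) * u i0.
  by rewrite sumr_const cardC1 card_ord -[LHS]mulr_natl bR1.
rewrite (bigD1 i0) //= -mulrA mulr2n mulrDl mul1r -cst; apply: lerD.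
  by apply: ler_sum => j _; exact: (mixi j).1.
apply: ler_sum => j ji0; rewrite (bigD1 i0) 1?eq_sym //=.
by rewrite (le_trans (mixi j).2) // lerDl; apply: sumr_ge0.
Qed.

(* Flipping coordinate [i] of a 0/1 vector by [u i] lowers each of the [b - 1]
   pair terms at [i] by at most [u i]. *)
Lemma sum_mix_flip_ge (s : 'I_b -> bool) (u : 'I_b -> R) :
  (forall i, 0 <= u i <= 1 / 2%:R) -> (exists i, s i) -> (exists i, ~~ s i) ->
  2%:R * (b%:R - 1) * (1 - \sum_(i < b) u i) <=
  \sum_(i < b) \sum_(j < b | j != i)
    mix (if s i then u i else 1 - u i) (if s j then u j else 1 - u j).
Proof.
move=> u01 [i1 si1] [i0 si0].
have pair i j : (s i != s j)%:R - (u i + u j) <=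
    mix (if s i then u i else 1 - u i) (if s j then u j else 1 - u j).
  have := u01 i; have := u01 j; rewrite /mix => /andP[? ?] /andP[? ?].
  by case: (s i); case: (s j) => /=; nra.
apply: le_trans (ler_sum _ (fun i _ => ler_sum _ (fun j _ => pair i j))).
under [X in _ <= X]eq_bigr do rewrite sumrB.
rewrite sumrB.
have -> : \sum_(i < b) \sum_(j < b | j != i) (u i + u j) =
    2%:R * (b%:R - 1) * \sum_(i < b) u i.
  under eq_bigr do rewrite big_split.
  rewrite big_split [X in _ + X = _](exchange_big_dep predT) //= -big_split.
  rewrite mulr_sumr; apply: eq_bigr => i _ /=.
  under [X in _ + X = _]eq_bigl do rewrite eq_sym.
  rewrite sumr_const cardC1 card_ord -[u i *+ _]mulr_natl bR1; ring.
rewrite mulrBr mulr1 lerD2r.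
pose o := #|[pred i | s i]|.
have ob : (o + #|[pred i | ~~ s i]| = b)%N.
  by rewrite -[RHS]card_ord -(cardC s).
have o1 : (0 < o)%N by apply/card_gt0P; exists i1.
have o0 : (0 < #|[pred i | ~~ s i]|)%N by apply/card_gt0P; exists i0.
have -> : \sum_(i < b) \sum_(j < b | j != i) (s i != s j)%:R =
    (2 * (o * #|[pred i | ~~ s i]|))%:R :> R.
  have row i : \sum_(j < b | j != i) (s i != s j)%:R =
      (if s i then #|[pred i | ~~ s i]| else o)%:R :> R.
    rewrite -natr_sum; congr (_%:R).
    have -> : (if s i then #|[pred i | ~~ s i]| else o) =
        (\sum_(j < b) (s i != s j))%N.
      by rewrite /o; case: (s i); rewrite -sum1_card big_mkcond; apply: eq_bigr => j _;
        rewrite inE; case: (s j).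
    by rewrite [RHS](bigD1 i) //= eqxx.
  under eq_bigr do rewrite row.
  rewrite (bigID s) /= (eq_bigr (fun=> #|[pred i | ~~ s i]|%:R)); last by move=> i ->.
  rewrite [X in _ + X](eq_bigr (fun=> o%:R)); last by move=> i /negbTE ->.
  rewrite !sumr_const -[X in X + _]mulr_natr -[X in _ + X]mulr_natr.
  by rewrite -!natrM -natrD -/o mulnC -mulnDr addnn -mul2n mulnCA.
(* Both sides of the 0/1 vector are nonempty, so [o (b - o) >= b - 1]. *)
rewrite -bR1 -natrM ler_nat leq_mul2l /=; nia.
Qed.


Lemma weight_prod h (t : R) (f : 'I_b -> {set leaf b h}) (P : pred 'I_b) :
  \prod_(i < b | P i) weight t (f i) =
  expR (- (lam * \sum_(i < b | P i) (cut_rate R (f i) + t * density R (f i)))).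
Proof.
by rewrite mulr_sumr -sumrN; elim/big_rec2: _ => [|i x y _ ->];
  rewrite ?expR0 // expRD.
Qed.

(** The whole mixed term is charged to [i0], raising its slope by [(b - 1) / b]; every child keeps
    its share [t / b] of the tilt. *)
Lemma weight_le_small_slices h t (A : {set leaf b h.+1}) (i0 : 'I_b) :
  (forall i, small (slice A i)) ->
  weight t A <= weight ((b%:R - 1 + t) / b%:R) (slice A i0) *
                \prod_(i < b | i != i0) weight (t / b%:R) (slice A i).
Proof.
move=> sA; rewrite weight_prod -expRD ler_expR -opprD lerN2 -mulrDr ler_pM2l //.
rewrite cut_rate_slices // density_slices //.
rewrite [\sum_(i < b) cut_rate R _](bigD1 i0) //=.
rewrite [\sum_(i < b) density R _](bigD1 i0) //= big_split /= -mulr_sumr.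
have := @sum_mix_ge (fun i => density R (slice A i)) i0.
have d01 i : 0 <= density R (slice A i) <= 1 / 2%:R.
  by rewrite density_ge0 density_small.
move=> /(_ d01); set m := (\sum_(i < b) _); set d := density R _.
set c := \sum_(i < b | _) cut_rate R _; set e := \sum_(i < b | _) density R _.
move=> mix_ge.
have : (b%:R - 1) / b%:R * d <= (2%:R * b%:R)^-1 * m.
  have -> : (b%:R - 1) / b%:R * d = (2%:R * b%:R)^-1 * (2%:R * (b%:R - 1) * d).
    by field; rewrite bRn0.
  by rewrite ler_pM2l // invr_gt0 mulr_gt0.
rewrite mulrDl mulrDl; lra.
Qed.

Lemma sum_mix_minority_ge h (A : {set leaf b h.+1}) :
  (exists i, small (slice A i)) -> (exists i, ~~ small (slice A i)) ->
  2%:R * (b%:R - 1) * (1 - \sum_(i < b) density R (minority (slice A i))) <=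
  \sum_(i < b) \sum_(j < b | j != i)
    mix (density R (slice A i)) (density R (slice A j)).
Proof.
move=> s1 s0; have d01 i : 0 <= density R (minority (slice A i)) <= 1 / 2%:R.
  by rewrite density_ge0 density_small // small_minority.
apply: le_trans (sum_mix_flip_ge d01 s1 s0) _.
rewrite le_eqVlt; apply/orP; left; apply/eqP; apply: eq_bigr => i _.
by apply: eq_bigr => j _; rewrite -!density_minority.
Qed.

(** Let [e] be the total minority density and [s = 1 - (1 - t) / b]. The mixed term and the tilt
    together give at least [s (1 - e) >= s - e], and [- e] becomes slope [-1] in the children. *)
Lemma weight_le_mixed h t (A : {set leaf b h.+1}) :
  (exists i, small (slice A i)) -> (exists i, ~~ small (slice A i)) ->
  0 <= t <= 1 ->
  weight t A <= expR (- (lam * (1 - (1 - t) / b%:R))) *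
                \prod_(i < b) weight (-1) (minority (slice A i)).
Proof.
move=> s1 s0 /andP[t0 t1].
rewrite weight_prod -expRD ler_expR -opprD lerN2 -mulrDr ler_pM2l //.
rewrite cut_rate_slices // density_slices //.
have := sum_mix_minority_ge s1 s0.
rewrite big_split /= -mulr_sumr.
under [\sum_(i < b) cut_rate R (minority _)]eq_bigr do rewrite cut_rate_minority.
set c := \sum_(i < b) cut_rate R _; set m := (\sum_(i < b) \sum_(j < b | _) _).
set e := \sum_(i < b) density R (minority _); set d := \sum_(i < b) density R _.
move=> mix_ge.
(* A single child lying mostly in [A] has density one minus its minority density. *)
have de : 1 - e <= d.
  case: s0 => i si; rewrite lerBlDr /d /e -big_split (bigD1 i) //=.
  rewrite [X in X + _ + _]density_minority (negbTE si) subrK lerDl.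
  by apply: sumr_ge0 => j _; rewrite addr_ge0 ?density_ge0.
have h1 : (b%:R - 1) / b%:R * (1 - e) <= (2%:R * b%:R)^-1 * m.
  have -> : (b%:R - 1) / b%:R * (1 - e) =
      (2%:R * b%:R)^-1 * (2%:R * (b%:R - 1) * (1 - e)).
    by field; rewrite bRn0.
  by rewrite ler_pM2l // invr_gt0 mulr_gt0.
have e0 : 0 <= e by apply: sumr_ge0 => i _; rewrite density_ge0.
have h2 : t / b%:R * (1 - e) <= t / b%:R * d.
  by rewrite ler_wpM2l // divr_ge0 // ltW.
have h3 : (1 - (1 - t) / b%:R) - e <= ((b%:R - 1) / b%:R + t / b%:R) * (1 - e).
  have -> : (b%:R - 1) / b%:R + t / b%:R = 1 - (1 - t) / b%:R by field.
  have : 0 <= (1 - t) / b%:R by rewrite divr_ge0 ?subr_ge0 // ltW.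
  by nra.
rewrite mulrA; lra.
Qed.

(** The case [0 <= t] produces slope [-1] in the children, so negative slopes need their own
    estimate. Smallness of [A] keeps the tilt above [t / 2], and the mixed term alone gives the
    children slope [- (b - 1) / b]. *)
Lemma weight_le_mixed_neg h t (A : {set leaf b h.+1}) :
  small A -> (exists i, small (slice A i)) -> (exists i, ~~ small (slice A i)) ->
  t <= 0 ->
  weight t A <= expR (- (lam * ((b%:R - 1) / b%:R + t / 2%:R))) *
    \prod_(i < b) weight (- ((b%:R - 1) / b%:R)) (minority (slice A i)).
Proof.
move=> sA s1 s0 t0.
rewrite weight_prod -expRD ler_expR -opprD lerN2 -mulrDr ler_pM2l //.
have tA : t / 2%:R <= t * density R A.
  have := density_small sA; nra.
rewrite cut_rate_slices //.
have := sum_mix_minority_ge s1 s0.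
rewrite big_split /= -mulr_sumr.
under [\sum_(i < b) cut_rate R (minority _)]eq_bigr do rewrite cut_rate_minority.
set c := \sum_(i < b) cut_rate R _; set m := (\sum_(i < b) \sum_(j < b | _) _).
set e := \sum_(i < b) density R (minority _) => mix_ge.
have : (b%:R - 1) / b%:R * (1 - e) <= (2%:R * b%:R)^-1 * m.
  have -> : (b%:R - 1) / b%:R * (1 - e) =
      (2%:R * b%:R)^-1 * (2%:R * (b%:R - 1) * (1 - e)).
    by field; rewrite bRn0.
  by rewrite ler_pM2l // invr_gt0 mulr_gt0.
lra.
Qed.


Lemma sum_slices h (F : 'I_b -> {set leaf b h} -> R) :
  \sum_(A : {set leaf b h.+1}) \prod_(i < b) F i (slice A i) =
  \prod_(i < b) \sum_(B : {set leaf b h}) F i B.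
Proof.
rewrite bigA_distr_bigA (reindex (@slices b h)) /=; last exact/onW_bij/slices_bij.
by apply: eq_bigr => A _; apply: eq_bigr => i _; rewrite ffunE.
Qed.

Lemma slice_neq0 h (A : {set leaf b h.+1}) :
  A != finset.set0 -> exists i, slice A i != finset.set0.
Proof.
have [g _ gK] := leaf_cons_bij b h.
case/set0Pn => v vA; exists (g v).1; apply/set0Pn; exists (g v).2.
by rewrite inE gK.
Qed.

(** Density averages over the children. So a small set whose slices are not all small has slices of
    both kinds. *)
Lemma small_slice h (A : {set leaf b h.+1}) :
  small A -> exists i, small (slice A i).
Proof.
move=> sA; apply/existsP; apply/negbNE/negP => /existsPn ns.
have : \sum_(i < b) (1 / 2%:R : R) < \sum_(i < b) density R (slice A i).
  apply: ltr_sum; first by apply/hasP; exists (Ordinal b_gt0) => //; rewrite mem_index_enum.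
  by move=> i _; rewrite ltNge density_le12 //; exact: ns.
rewrite sumr_const card_ord -mulr_natl.
have := density_small sA; rewrite density_slices // ler_pdivrMl //; lra.
Qed.

Lemma sum_small_slices h t :
  \sum_(A : {set leaf b h.+1} | (A != finset.set0) &&
      [forall i, small (slice A i)]) weight t A <=
  b%:R * defect h ((b%:R - 1 + t) / b%:R) * (1 + defect h (t / b%:R)) ^+ b.-1.
Proof.
(* [i0] is a child with nonempty slice; summing over its [b] choices overcounts but makes the sum
   over [A] a product over children. *)
pose F (i0 i : 'I_b) (B : {set leaf b h}) : R :=
  if i == i0 then if (B != finset.set0) && small B
                  then weight ((b%:R - 1 + t) / b%:R) B else 0
  else if small B then weight (t / b%:R) B else 0.
have F0 i0 i B : 0 <= F i0 i B.
  by rewrite /F; do 2!case: ifP => _ //; rewrite weight_ge0.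
apply: (@le_trans _ _ (\sum_(A : {set leaf b h.+1}) \sum_(i0 < b)
    \prod_(i < b) F i0 i (slice A i))); last first.
  rewrite exchange_big /= (eq_bigr (fun=> defect h ((b%:R - 1 + t) / b%:R) *
      (1 + defect h (t / b%:R)) ^+ b.-1)).
    by rewrite sumr_const card_ord -[leLHS]mulr_natl mulrA.
  move=> i0 _; rewrite sum_slices (bigD1 i0) //=; congr (_ * _).
    by rewrite /F eqxx -big_mkcond.
  rewrite (eq_bigr (fun=> 1 + defect h (t / b%:R))).
    by rewrite prodr_const cardC1 card_ord.
  by move=> i /negbTE i0i; rewrite /F i0i -big_mkcond sum_small.
rewrite big_mkcond; apply: ler_sum => A _; case: ifPn => [|_]; last first.
  by apply: sumr_ge0 => i0 _; apply: prodr_ge0 => i _.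
case/andP => /slice_neq0[i0 A0] /forallP sA; rewrite (bigD1 i0) //=.
rewrite (le_trans (weight_le_small_slices t i0 sA)) //.
have Fi0 : F i0 i0 (slice A i0) = weight ((b%:R - 1 + t) / b%:R) (slice A i0).
  by rewrite /F eqxx A0 sA.
rewrite [X in _ <= X + _](bigD1 i0) //= Fi0.
rewrite (eq_bigr (fun i => F i0 i (slice A i))).
  by rewrite lerDl; apply: sumr_ge0 => i1 _; apply: prodr_ge0 => i _.
by move=> i /negbTE i0i; rewrite /F i0i sA.
Qed.

Lemma sum_prod_minority h t :
  \sum_(A : {set leaf b h.+1}) \prod_(i < b) weight t (minority (slice A i)) <=
  (2%:R * (1 + defect h t)) ^+ b.
Proof.
rewrite (sum_slices (fun _ B => weight t (minority B))) prodr_const card_ord.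
rewrite lerXn2r ?nnegrE ?sum_minority //; first by apply: sumr_ge0 => A _; exact: weight_ge0.
by rewrite mulr_ge0 // addr_ge0 // defect_ge0.
Qed.

(** Common form of the two recursions: [C] and [c] are the factor and the child slope of the mixed
    case. *)
Lemma defect_succ h t (C c : R) : 0 <= C ->
  (forall A : {set leaf b h.+1}, small A -> (exists i, small (slice A i)) ->
    (exists i, ~~ small (slice A i)) ->
    weight t A <= C * \prod_(i < b) weight c (minority (slice A i))) ->
  defect h.+1 t <=
  b%:R * defect h ((b%:R - 1 + t) / b%:R) * (1 + defect h (t / b%:R)) ^+ b.-1 +
  C * (2%:R * (1 + defect h c)) ^+ b.
Proof.
move=> C0 wA; rewrite /defect (bigID (fun A => [forall i, small (slice A i)])) /=.
apply: lerD.
  apply: le_trans (sum_small_slices h t).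
  rewrite [leLHS]big_mkcond [leRHS]big_mkcond; apply: ler_sum => A _ /=.
  case: (A == finset.set0) => //=; case: (small A) => //=.
  by case: ifP => // _; exact: weight_ge0.
apply: le_trans (ler_wpM2l C0 (sum_prod_minority h c)).
rewrite mulr_sumr [leLHS]big_mkcond; apply: ler_sum => A _.
case: ifPn => [/andP[/andP[_ sA] /forallPn ns]|_].
  by apply: wA => //; exact: small_slice.
by rewrite mulr_ge0 // prodr_ge0 // => i _; exact: weight_ge0.
Qed.

Lemma defect_succ_pos h t : 0 <= t <= 1 ->
  defect h.+1 t <=
  b%:R * defect h (1 - (1 - t) / b%:R) * (1 + defect h 0) ^+ b.-1 +
  expR (- (lam * (1 - (1 - t) / b%:R))) * (2%:R * (1 + defect h (-1))) ^+ b.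
Proof.
move=> t01; have /andP[t0 t1] := t01.
have -> : 1 - (1 - t) / b%:R = (b%:R - 1 + t) / b%:R by field.
apply: le_trans (@defect_succ h t (expR (- (lam * ((b%:R - 1 + t) / b%:R)))) (-1)
  (expR_ge0 _) _) _.
  move=> A sA s1 s0; have -> : (b%:R - 1 + t) / b%:R = 1 - (1 - t) / b%:R by field.
  exact: weight_le_mixed.
rewrite lerD2r ler_wpM2l ?mulr_ge0 ?defect_ge0 // lerXn2r ?nnegrE //.
- by rewrite addr_ge0 // defect_ge0.
- by rewrite addr_ge0 // defect_ge0.
- by rewrite lerD2l defect_le // divr_ge0.
Qed.

(** The lower bound on [t] makes the slope of the distinguished child nonnegative and that of the
    others at least [- (b - 1) / b]. By monotonicity only the slopes [0] and [- (b - 1) / b] remain,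
    which lets an induction close. *)
Lemma defect_succ_neg h t :
  - (b%:R - 1) <= t <= 0 ->
  defect h.+1 t <=
  b%:R * defect h 0 * (1 + defect h (- ((b%:R - 1) / b%:R))) ^+ b.-1 +
  expR (- (lam * ((b%:R - 1) / b%:R + t / 2%:R))) *
    (2%:R * (1 + defect h (- ((b%:R - 1) / b%:R)))) ^+ b.
Proof.
move=> /andP[tb t0]; set c := - _.
apply: le_trans (@defect_succ h t (expR (- (lam * ((b%:R - 1) / b%:R + t / 2%:R)))) c
  (expR_ge0 _) _) _.
  by move=> A sA s1 s0; exact: weight_le_mixed_neg.
rewrite lerD2r ler_pM ?mulr_ge0 ?exprn_ge0 ?addr_ge0 ?defect_ge0 //.
  by rewrite ler_wpM2l // defect_le // divr_ge0 // addrC -lerBlDr sub0r.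
rewrite lerXn2r ?nnegrE ?addr_ge0 ?defect_ge0 // lerD2l defect_le //.
by rewrite /c -mulNr ler_wpM2r // invr_ge0 ltW.
Qed.

Lemma defect_0 t : defect 0 t = 0.
Proof.
rewrite /defect big1 // => A /andP[A0]; rewrite /small expn0.
by rewrite -card_gt0 in A0; lia.
Qed.

End Recursion.

(** * Solving the defect recursion *)

Section DefectBound.
Variables (R : realType) (b n : nat) (f : R).
Hypotheses (b_ge2 : (2 <= b)%N) (f_ge0 : 0 <= f).
Let L : R := ln b%:R.
Let lam : R := n%:R * L + f.
Hypothesis lam_gt0 : 0 < lam.

Let bR2 : 2%:R <= b%:R :> R. Proof. by rewrite ler_nat. Qed.
Let bR0 : 0 < b%:R :> R. Proof. by rewrite ltr0n ltnW. Qed.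
Let bRn0 : b%:R != 0 :> R. Proof. by rewrite lt0r_neq0. Qed.
Let expL : expR L = b%:R. Proof. by rewrite lnK // posrE. Qed.
Let L_gt0 : 0 < L. Proof. by rewrite ln_gt0 // ltr1n. Qed.

Let beta : R := expR (L / 2%:R).
Let beta_gt0 : 0 < beta. Proof. exact: expR_gt0. Qed.
(** [beta] is the square root of [b]. The value [4/3] makes the geometric sum of the [q j], [j < h],
    at most [3 q h], and gives [q (h + 1) - q h >= q h / 3]. *)
Let beta_ge : 4%:R / 3%:R <= beta.
Proof.
have : beta ^+ 2 = b%:R.
  by rewrite /beta -expRM_natl mulrC divfK ?expL // pnatr_eq0.
move=> beta2; rewrite leNgt; apply/negP => lt43.
have : beta ^+ 2 < (4%:R / 3%:R) ^+ 2 by rewrite ltrXn2r ?nnegrE ?ltW.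
by rewrite beta2 => /(le_lt_trans bR2); lra.
Qed.
Let q h : R := beta ^+ h / beta ^+ n.

(** The [3] comes from the geometric sum, [expR 1] from the accumulated factors
    [(1 + D_h(0))^(b-1)], and the last factor [K] from the mixed case. *)
Definition defect_const : R :=
  3%:R * expR 1 * (2%:R * (2%:R + 4%:R ^+ b)) ^+ b.
Let K : R := (2%:R * (2%:R + 4%:R ^+ b)) ^+ b.
(** One summand for each smallness condition in the induction: the growth of [expR (q h)], the
    linear term at negative slopes, and the mixed term at slope [c0]. *)
Definition defect_scale : R :=
  3%:R * b%:R * defect_const + b%:R * 2%:R ^+ b * defect_const + 4%:R ^+ b.
(** The rate [1/4] is what the mixed case leaves at slope [c0], where the exponent is
    [(b - 1) / (2 b) >= 1/4]. *)
Let g : R := expR (- (f / 4%:R)).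
Hypothesis f_large : defect_scale * g <= 1.

(** The linear recursion unrolled from zero: after [j] steps the multiplicity is [b^j] and [1 - t]
    has shrunk by [b^j]. *)
Let sigma h (t : R) : R := \sum_(j < h)
  b%:R ^+ j * expR (- (lam * (1 - (1 - t) / b%:R ^+ j.+1))).

Let sigmaS h t : sigma h.+1 t =
  expR (- (lam * (1 - (1 - t) / b%:R))) + b%:R * sigma h (1 - (1 - t) / b%:R).
Proof.
rewrite /sigma big_ord_recl mul1r expr1; congr (_ + _).
rewrite mulr_sumr; apply: eq_bigr => j _.
rewrite lift0 [b%:R ^+ j.+1]exprS -mulrA; congr (_ * (_ * expR (- (_ * (1 - _))))).
by rewrite subKr -exprS [in LHS]exprS invfM mulrA.
Qed.

Let term_le j : (j < n)%N ->
  b%:R ^+ j * expR (- (lam * (1 - 1 / b%:R ^+ j.+1))) <=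
  beta ^+ j / beta ^+ n * g.
Proof.
move=> jn; set e := 1 / b%:R ^+ j.+1.
have e2 : e <= 1 / 2%:R ^+ j.+1.
  rewrite /e ler_pM2l // lef_pV2 ?posrE ?exprn_gt0 //.
  by rewrite lerXn2r // nnegrE ltW.
have p2 : 0 < 2%:R ^+ j :> R by rewrite exprn_gt0.
(* Equivalently [(n - j) 2^j >= n], which holds because [2^j >= j + 1] and [n - j >= 1]. *)
have nj : j%:R * 2%:R ^+ j <= n%:R * (2%:R ^+ j - 1) :> R.
  have j2 : j%:R + 1 <= 2%:R ^+ j :> R.
    by rewrite natr1 -natrX ler_nat ltn_expl.
  have : j%:R + 1 <= n%:R :> R by rewrite natr1 ler_nat.
  by have := ler0n R j; nra.
have e12 : e <= 1 / 2%:R.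
  rewrite (le_trans e2) // ler_pM2l // lef_pV2 ?posrE ?exprn_gt0 //.
  by rewrite exprS ler_peMr // exprn_ege1 // ler1n.
rewrite -[X in X ^+ j]expL /beta /g -!expRM_natl -expRN -!expRD ler_expR.
have le1 : j%:R + n%:R * e <= (n%:R + j%:R) / 2%:R.
  have ne : n%:R * e <= n%:R * (1 / 2%:R ^+ j.+1) by rewrite ler_wpM2l.
  have : n%:R * (1 / 2%:R ^+ j.+1) <= (n%:R - j%:R) / 2%:R :> R.
    rewrite mul1r exprS invfM mulrCA mulrC ler_pM2r ?invr_gt0 //.
    by rewrite ler_pdivrMr //; nra.
  lra.
have Le : L * (j%:R + n%:R * e) <= L * ((n%:R + j%:R) / 2%:R) by rewrite ler_pM2l.
have fe : f * e <= f * (1 / 2%:R) by rewrite ler_wpM2l.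
have key (j' n' e' L' f' : R) : L' * (j' + n' * e') <= L' * ((n' + j') / 2%:R) ->
    f' * e' <= f' * (1 / 2%:R) -> 0 <= f' ->
    j' * L' - (n' * L' + f') * (1 - e') <= j' * (L' / 2%:R) - n' * (L' / 2%:R) - f' / 4%:R.
  by move=> *; lra.
exact: key.
Qed.

Let q_ge0 h : 0 <= q h.
Proof. by rewrite divr_ge0 // exprn_ge0 // ltW. Qed.

Let q_le1 h : (h <= n)%N -> q h <= 1.
Proof.
move=> hn; rewrite ler_pdivrMr ?exprn_gt0 // mul1r ler_weXn2l //.
by have := beta_ge; lra.
Qed.

Let sigma_le h : (h <= n)%N -> sigma h 0 <= 3%:R * q h * g.
Proof.
move=> hn; apply: (@le_trans _ _ (\sum_(j < h) q j * g)).
  apply: ler_sum => j _; rewrite subr0; apply: term_le.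
  exact: leq_trans (ltn_ord j) hn.
rewrite -mulr_suml ler_wpM2r ?expR_ge0 //.
elim: h {hn} => [|h IH]; first by rewrite big_ord0 mulr_ge0.
rewrite big_ord_recr /=; have -> : q h.+1 = beta * q h by rewrite /q exprS mulrA.
by have := beta_ge; have := q_ge0 h; nra.
Qed.

Let K_ge0 : 0 <= K. Proof. by rewrite exprn_ge0 // mulr_ge0 // addr_ge0 // exprn_ge0. Qed.
Let C_ge0 : 0 <= defect_const.
Proof. by rewrite !mulr_ge0 // expR_ge0. Qed.
Let g_ge0 : 0 <= g. Proof. exact: expR_ge0. Qed.

Let c0 : R := - ((b%:R - 1) / b%:R).
Let D := @defect R b lam.

Let X_le h : (h <= n)%N ->
  D h 0 <= expR (q h) * K * sigma h 0 -> D h 0 <= defect_const * q h * g.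
Proof.
move=> hn /le_trans; apply.
apply: (@le_trans _ _ (expR 1 * K * (3%:R * q h * g))); last first.
  by rewrite /defect_const -/K le_eqVlt; apply/orP; left; apply/eqP; ring.
rewrite ler_pM ?mulr_ge0 ?expR_ge0 ?sigma_le ?ler_wpM2r ?ler_expR ?q_le1 //.
by apply: sumr_ge0 => j _; rewrite mulr_ge0 ?expR_ge0 // exprn_ge0 // ltW.
Qed.

(** The three bounds feed each other: nonnegative slopes call slope [-1], and both negative slopes
    call [0] and [c0]. The factor [expR (q h)] leaves room for the powers of [1 + D h 0]. *)
Let defect_ind h : (h <= n)%N ->
  [/\ forall t : R, 0 <= t <= 1 -> D h t <= expR (q h) * K * sigma h t,
      D h c0 <= 1 & D h (-1) <= 1 + 4%:R ^+ b].
Proof.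
elim: h => [_|h IH hn].
  split=> [t _||]; rewrite /D defect_0 ?ler01 //.
    by rewrite /sigma big_ord0 mulr0.
have [IHt IHY IHZ] := IH (ltnW hn).
have X : D h 0 <= defect_const * q h * g.
  by apply: X_le (ltnW hn) (IHt _ _); rewrite lexx ler01.
have D0 t : 0 <= D h t by exact: defect_ge0.
have qg : q h * g <= g by rewrite ler_piMl // q_le1 // ltnW.
have C4 : 0 <= 4%:R ^+ b :> R by rewrite exprn_ge0.
have C2 : 0 <= b%:R * 2%:R ^+ b * defect_const.
  by rewrite !mulr_ge0 // exprn_ge0.
have C3 : 0 <= 3%:R * b%:R * defect_const by rewrite !mulr_ge0.
have Mg : (3%:R * b%:R * defect_const) * g + (b%:R * 2%:R ^+ b * defect_const) * g
   + 4%:R ^+ b * g <= 1 by move: f_large; rewrite /defect_scale !mulrDl.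
have [C3g C2g C4g] : [/\ 0 <= (3%:R * b%:R * defect_const) * g,
  0 <= (b%:R * 2%:R ^+ b * defect_const) * g & 0 <= 4%:R ^+ b * g].
  by split; rewrite mulr_ge0.
have bX : b%:R * D h 0 * (1 + D h c0) ^+ b.-1 <= b%:R * 2%:R ^+ b * defect_const * g.
  apply: (@le_trans _ _ (b%:R * (defect_const * g) * 2%:R ^+ b)); last by lra.
  rewrite ler_pM ?mulr_ge0 ?exprn_ge0 ?addr_ge0 //.
    by rewrite ler_wpM2l // (le_trans X) // -mulrA ler_wpM2l.
  apply: (@le_trans _ _ (2%:R ^+ b.-1)).
    by rewrite lerXn2r ?nnegrE ?addr_ge0 //; lra.
  by rewrite ler_weXn2l ?ler1n // leq_pred.
have b4 : (2%:R * (1 + D h c0)) ^+ b <= 4%:R ^+ b.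
  by rewrite lerXn2r ?nnegrE ?mulr_ge0 ?addr_ge0 //; lra.
split=> [t t01||].
- have /andP[t0 t1] := t01.
  apply: le_trans (defect_succ_pos b_ge2 lam_gt0 h t01) _.
  rewrite sigmaS [leRHS]mulrDr [leLHS]addrC; apply: lerD.
    rewrite mulrC ler_wpM2r ?expR_ge0 //.
    apply: (@le_trans _ _ K); last by rewrite ler_peMl // -expR0 ler_expR.
    rewrite lerXn2r ?nnegrE ?mulr_ge0 ?addr_ge0 ?defect_ge0 //.
    by rewrite ler_wpM2l //; move: IHZ; rewrite /D; lra.
  set t' := 1 - _.
  have t'01 : 0 <= t' <= 1.
    rewrite /t' subr_ge0 gerBl divr_ge0 ?subr_ge0 // andbT ler_pdivrMr //.
    by rewrite mul1r; have := bR2; lra.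
  have s0 : 0 <= sigma h t'.
    by apply: sumr_ge0 => j _; rewrite mulr_ge0 ?expR_ge0 // exprn_ge0 // ltW.
  have pow : (1 + D h 0) ^+ b.-1 <= expR (b.-1%:R * D h 0).
    by rewrite expRM_natl lerXn2r ?nnegrE ?expR_ge0 ?expR_ge1Dx // addr_ge0.
  (* By the first summand of [defect_scale], [(b - 1) D_h(0) <= q h / 3], which is at most the
     increment of [q]. *)
  have grow : expR (q h) * expR (b.-1%:R * D h 0) <= expR (q h.+1).
    rewrite -expRD ler_expR.
    have -> : q h.+1 = beta * q h by rewrite /q exprS mulrA.
    have : b.-1%:R * D h 0 <= b%:R * (defect_const * q h * g).
      by rewrite ler_pM // ler_nat leq_pred.
    have : b%:R * defect_const * g * q h <= 1 / 3%:R * q h.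
      by rewrite ler_wpM2r //; lra.
    by have := beta_ge; have := q_ge0 h; nra.
  have := IHt _ t'01 => IHt'.
  apply: (@le_trans _ _ (b%:R * (expR (q h) * K * sigma h t') * expR (b.-1%:R * D h 0))).
    by rewrite ler_pM ?mulr_ge0 ?exprn_ge0 ?addr_ge0 ?defect_ge0 // ler_wpM2l.
  have -> : b%:R * (expR (q h) * K * sigma h t') * expR (b.-1%:R * D h 0) =
    expR (q h) * expR (b.-1%:R * D h 0) * K * (b%:R * sigma h t') by ring.
  by rewrite ler_wpM2r ?mulr_ge0 // ler_wpM2r.
- apply: le_trans (defect_succ_neg b_ge2 lam_gt0 h _) _.
    rewrite /c0 lerN2 oppr_le0 divr_ge0 ?andbT ?subr_ge0 ?ler1n ?(ltnW b_ge2) //.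
    by rewrite ler_pdivrMr // ler_peMr ?subr_ge0 ?ler1n ?(ltnW b_ge2).
  rewrite -/c0 -/(D h c0) -/(D h 0).
  have yg : expR (- (lam * ((b%:R - 1) / b%:R + c0 / 2%:R))) <= g.
    rewrite /g ler_expR lerN2.
    have e4 : 1 / 4%:R <= (b%:R - 1) / b%:R + c0 / 2%:R.
      have -> : (b%:R - 1) / b%:R + c0 / 2%:R = (b%:R - 1) / (2%:R * b%:R).
        by rewrite /c0; field.
      rewrite ler_pdivlMr ?mulr_gt0 //; have := bR2; lra.
    apply: (@le_trans _ _ (lam * (1 / 4%:R))); last by rewrite ler_pM2l.
    have : 0 <= n%:R * L by rewrite mulr_ge0 // ltW.
    rewrite /lam; lra.
  have : expR (- (lam * ((b%:R - 1) / b%:R + c0 / 2%:R))) *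
     (2%:R * (1 + D h c0)) ^+ b <= g * 4%:R ^+ b.
    by rewrite ler_pM ?expR_ge0 ?exprn_ge0 ?mulr_ge0 ?addr_ge0.
  lra.
- apply: le_trans (defect_succ_neg b_ge2 lam_gt0 h _) _.
    by rewrite lerN2 oppr_le0 ler01 andbT; have := bR2; lra.
  rewrite -/c0 -/(D h c0) -/(D h 0).
  (* The coefficient of [lam] is [(b - 2) / (2 b)], which vanishes at [b = 2]; so slope [-1] gets a
     constant bound and no decay. *)
  have y1 : expR (- (lam * ((b%:R - 1) / b%:R + -1 / 2%:R))) <= 1.
    rewrite expR_le1 oppr_le0 mulr_ge0 ?(ltW lam_gt0) //.
    have -> : (b%:R - 1) / b%:R + -1 / 2%:R = (b%:R - 2%:R) / (2%:R * b%:R) :> R.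
      by field.
    by rewrite divr_ge0 ?mulr_ge0 ?subr_ge0.
  have : expR (- (lam * ((b%:R - 1) / b%:R + -1 / 2%:R))) *
     (2%:R * (1 + D h c0)) ^+ b <= 1 * 4%:R ^+ b.
    by rewrite ler_pM ?expR_ge0 ?exprn_ge0 ?mulr_ge0 ?addr_ge0.
  lra.
Qed.

Lemma defect_bound : defect b lam n 0 <= defect_const * g.
Proof.
have [H _ _] := defect_ind (leqnn n).
have : D n 0 <= defect_const * q n * g.
  by apply: X_le (leqnn n) (H _ _); rewrite lexx ler01.
by rewrite /q divff ?mulr1 // expf_neq0 // lt0r_neq0.
Qed.

End DefectBound.

(** * Independent supports *)

Section Support.
Local Open Scope classical_set_scope.
Variables (R : realType) (d : measure_display) (T : measurableType d).
Variables (P : probability T R) (I : finType) (X : I -> {RV P >-> nat}).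
Hypothesis indepX : mutually_independent X.

Definition support_of (w : T) : {set I} := [set i | (0 < X i w)%N]%SET.

(** Isolation and connectivity depend only on which pairs carry an edge, so all probabilities become
    finite sums against this law. *)
Definition support_pmf (S : {set I}) : R := fine (P [set w | support_of w = S]).

Definition zero_prob (i : I) : R := fine (P (X i @^-1` [set 0%N])).

Let cyl (K : {set I}) (S : {set I}) : set T :=
  \bigcap_(i in [set` K]) (X i @^-1` (if i \in S then ~` [set 0%N] else [set 0%N])).

Let cylE K S : cyl K S = [set w | (support_of w :&: K = S :&: K)%SET].
Proof.
apply/seteqP; split => w /=.
  move=> c; apply/setP => i; rewrite !inE; have [iK|] := boolP (i \in K); last by rewrite !andbF.
  have := c i iK; rewrite /= !andbT; case: (i \in S) => /=.
    by move/eqP; rewrite lt0n.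
  by move=> ->.
move=> /setP e i iK /=; have := e i; rewrite !inE iK !andbT => <-.
by case: ifP => /=; rewrite lt0n => /eqP.
Qed.

Let measurable_cyl K S : measurable (cyl K S).
Proof.
apply: fin_bigcap_measurable; first exact: finite_finset.
by move=> i _; exact: measurable_funPTI.
Qed.

Let prob_fin (A : set T) : measurable A -> P A = (fine (P A))%:E.
Proof. by move=> mA; rewrite fineK // fin_num_measure. Qed.

Let prob_cyl K S : fine (P (cyl K S)) =
  \prod_(i in K) fine (P (X i @^-1` (if i \in S then ~` [set 0%N] else [set 0%N]))).
Proof.
rewrite /cyl indepX; last by [].
rewrite (_ : (\prod_(i in K) _)%E = (\prod_(i in K) fine (P (X i @^-1`
    (if i \in S then ~` [set 0%N] else [set 0%N]))))%:E) //.
elim/big_rec2: _ => [//|i x y _ ->]; rewrite EFinM -prob_fin //.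
exact: measurable_funPTI.
Qed.

Lemma measurable_support (p : pred {set I}) :
  measurable [set w | p (support_of w)].
Proof.
have -> : [set w | p (support_of w)] = \bigcup_(S in [set` p]) cyl finset.setT S.
  apply/seteqP; split => w /=.
    by move=> pw; exists (support_of w) => //; rewrite cylE /=.
  by case=> S /= pS; rewrite cylE /= !finset.setIT => ->.
by apply: fin_bigcup_measurable => [|S _]; [exact: finite_finset|exact: measurable_cyl].
Qed.

Lemma prob_support (p : pred {set I}) :
  P [set w | p (support_of w)] = (\sum_(S | p S) support_pmf S)%:E.
Proof.
have mS S : measurable [set w | support_of w = S].
  rewrite (_ : [set w | _] = cyl finset.setT S) //; rewrite cylE.
  by apply/seteqP; split => w /=; rewrite !finset.setIT.
have key (s : seq {set I}) : uniq s ->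
    P [set w | support_of w \in s] = (\sum_(S <- s) support_pmf S)%:E.
  elim: s => [_|S s IH /= /andP[Ss us]].
    rewrite big_nil (_ : [set w | _] = set0) ?measure0 //.
    by apply/seteqP; split => w.
  rewrite big_cons EFinD -(IH us) /support_pmf -prob_fin // -measureU //.
  - by congr (P _); apply/seteqP; split => w /=; rewrite in_cons;
      [case/orP => [/eqP|]; [left|right]|case=> [->|->]; rewrite ?eqxx ?orbT].
  - exact: (measurable_support (fun S => S \in s)).
  - apply/seteqP; split => w //= [ws]; rewrite ws => /negP; case.
    by rewrite (negbTE Ss).
rewrite -big_filter -key ?filter_uniq ?index_enum_uniq //.
by congr (P _); apply/seteqP; split => w /=; rewrite mem_filter mem_index_enum andbT.
Qed.

Lemma support_pmf_ge0 S : 0 <= support_pmf S.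
Proof. by rewrite fine_ge0. Qed.

Lemma sum_support_pmf : \sum_S support_pmf S = 1.
Proof.
have := prob_support predT; rewrite (_ : [set w | _] = setT).
  by rewrite probability_setT => -[] ->.
by apply/seteqP; split.
Qed.

(** Independence in the form used later: conditioning on an empty support in [K] does not change the
    law of the support outside [K]. *)
Lemma sum_support_cond (K : {set I}) (phi : {set I} -> R) :
  \sum_(S : {set I} | (S :&: K)%SET == finset.set0) support_pmf S * phi (S :\: K)%SET =
  (\prod_(i in K) zero_prob i) * \sum_(S : {set I}) support_pmf S * phi (S :\: K)%SET.
Proof.
rewrite (partition_big (fun S => S :\: K)%SET predT) //=.
rewrite [in RHS](partition_big (fun S => S :\: K)%SET predT) //= mulr_sumr.
apply: eq_bigr => U _.
transitivity ((\sum_(S : {set I} | ((S :&: K)%SET == finset.set0) && ((S :\: K)%SET == U))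
    support_pmf S) * phi U).
  by rewrite mulr_suml; apply: eq_bigr => S /andP[_ /eqP ->].
transitivity ((\prod_(i in K) zero_prob i) *
    (\sum_(S : {set I} | (S :\: K)%SET == U) support_pmf S) * phi U); last first.
  by rewrite -mulrA mulr_suml; congr (_ * _); apply: eq_bigr => S /eqP ->.
congr (_ * _); have [KU|KU] := eqVneq (U :&: K)%SET finset.set0; last first.
  have noU S : ((S :\: K)%SET == U) = false.
    apply: contraNF KU => /eqP <-; rewrite -finset.subset0.
    by apply/fintype.subsetP => i; rewrite !inE; case: (i \in K); rewrite ?andbF.
  rewrite [RHS]mulrC [X in _ = X * _]big_pred0 ?mul0r; last exact: noU.
  by apply: big_pred0 => S; rewrite noU andbF.
(* For [U] disjoint from [K], the two fibres are cylinder events over all indices and over the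
   complement of [K]; their probabilities differ by the product over [K]. *)
have splitc S : ((S :&: K)%SET == finset.set0) && ((S :\: K)%SET == U) =
    ((S :&: finset.setT)%SET == (U :&: finset.setT)%SET).
  rewrite !finset.setIT; apply/andP/eqP => [[/eqP S0 /eqP <-]|->].
    by rewrite -[LHS](finset.setID S K) S0 finset.set0U.
  by rewrite KU finset.setDE; split=> //; apply/eqP/finset.setIidPl;
    rewrite -finset.disjoints_subset -finset.setI_eq0 KU.
have splitU S : ((S :\: K)%SET == U) = ((S :&: ~: K)%SET == (U :&: ~: K)%SET).
  rewrite finset.setDE; congr (_ == _); apply/esym/finset.setIidPl.
  by rewrite -finset.disjoints_subset -finset.setI_eq0 KU.
have cylP J : \sum_(S : {set I} | (S :&: J)%SET == (U :&: J)%SET) support_pmf S =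
    fine (P (cyl J U)).
  rewrite cylE.
  rewrite (_ : [set w | _] = [set w | (support_of w :&: J)%SET == (U :&: J)%SET]).
    by rewrite (prob_support (fun S => (S :&: J)%SET == (U :&: J)%SET)).
  by apply/seteqP; split => w /= /eqP.
rewrite (eq_bigl _ _ splitc) cylP (eq_bigl _ _ splitU) cylP !prob_cyl.
rewrite (bigID (mem K)) /=; congr (_ * _).
  apply: eq_big => [i|i /andP[_ iK]]; first by rewrite finset.in_setT.
  rewrite ifF //; apply/negP => iU; move/setP/(_ i): KU.
  by rewrite !inE iU iK.
by apply: eq_bigl => i; rewrite !inE.
Qed.

End Support.

(** * Cuts and isolated vertices of a set of pairs *)

Section SimpleGraph.
Variable V : finType.

Definition crossing (A : {set V}) : {set upair V} :=
  [set e : upair V | #|val e :&: A| == 1%N].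

Definition edge_rel (S : {set upair V}) : rel V :=
  fun x y => [exists e : upair V, (val e == [set x; y]%SET) && (e \in S)].

(** Stated through the cut of a singleton, so that isolation and disconnection are both events of
    avoiding a set of pairs. *)
Definition is_isolated (S : {set upair V}) (x : V) : bool :=
  (S :&: crossing [set x]%SET)%SET == finset.set0.

Lemma crossingP (A : {set V}) (e : upair V) :
  reflect (exists x y, [/\ x \in A, y \notin A & val e = [set x; y]%SET])
          (e \in crossing A).
Proof.
rewrite inE; apply: (iffP idP) => [|[x [y [xA yA ->]]]]; last first.
  rewrite (_ : ([set x; y] :&: A)%SET = [set x]%SET) ?cards1 //.
  apply/setP => z; rewrite !inE; have [->|_] := eqVneq z x; first by rewrite xA.
  by have [->|] := eqVneq z y; rewrite ?(negbTE yA).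
have /cards2P[x [y [xy ->]]] := valP e.
have [xA|xA] := boolP (x \in A); have [yA|yA] := boolP (y \in A).
- have -> : ([set x; y] :&: A)%SET = [set x; y]%SET.
    apply/setP => z; rewrite !inE; have [->|_] := eqVneq z x; first by rewrite xA.
    by have [->|] := eqVneq z y; rewrite ?yA.
  by rewrite cards2 xy.
- by exists x, y.
- by exists y, x; rewrite finset.setUC.
- have -> : ([set x; y] :&: A)%SET = finset.set0.
    apply/setP => z; rewrite !inE; have [->|_] := eqVneq z x; first by rewrite (negbTE xA).
    by have [->|] := eqVneq z y; rewrite ?(negbTE yA).
  by rewrite cards0.
Qed.

Lemma upair_exists (x y : V) : x != y -> exists e : upair V, val e = [set x; y]%SET.
Proof.
move=> xy; have c2 : #|[set x; y]%SET| == 2 by rewrite cards2 xy.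
by exists (Sub [set x; y]%SET c2); rewrite SubK.
Qed.

Lemma crossing1 (x : V) (e : upair V) : (e \in crossing [set x]%SET) = (x \in val e).
Proof.
apply/crossingP/idP => [[u [v []]]|].
  by rewrite inE => /eqP -> _ ->; rewrite !inE eqxx.
have /cards2P[u [v [uv ->]]] := valP e.
rewrite !inE => /orP[] /eqP ->.
  by exists u, v; rewrite !inE eqxx eq_sym.
by exists v, u; rewrite !inE eqxx uv finset.setUC.
Qed.

Lemma is_isolatedP (S : {set upair V}) (x : V) :
  is_isolated S x = [forall y, ~~ edge_rel S x y].
Proof.
apply/eqP/forallP => [S0 y|noadj].
  apply/existsPn => e; apply/negP => /andP[/eqP ve eS].
  move/setP/(_ e): S0; rewrite finset.in_setI eS crossing1 ve !inE eqxx.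
  by [].
apply/setP => e; rewrite finset.in_setI crossing1 [RHS]inE.
apply/negP => /andP[eS xe].
have /crossingP[u [v []]] : e \in crossing [set x]%SET by rewrite crossing1.
rewrite inE => /eqP -> _ ve.
by have /existsPn/(_ e) := noadj v; rewrite ve eqxx eS.
Qed.

(* The component of a vertex, or its complement, is the required cut. *)
Lemma disconnected_cut (S : {set upair V}) :
  ~~ [forall x, forall y, connect (edge_rel S) x y] ->
  exists A : {set V}, [/\ A != finset.set0, (2 * #|A| <= #|V|)%N &
    (S :&: crossing A)%SET == finset.set0].
Proof.
case/forallPn => x /forallPn [y xy].
pose A := [set z | connect (edge_rel S) x z]%SET.
have cutA : (S :&: crossing A)%SET == finset.set0.
  rewrite -finset.subset0; apply/fintype.subsetP => e; rewrite finset.in_setI.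
  case/andP => eS /crossingP[u [v [uA vA ve]]]; case/negP: vA.
  rewrite inE in uA; rewrite inE (connect_trans uA) // connect1 //.
  by apply/existsP; exists e; rewrite ve eqxx.
have [sA|sA] := leqP (2 * #|A|) #|V|.
  by exists A; split=> //; apply/set0Pn; exists x; rewrite inE connect0.
exists (~: A)%SET; split.
- by apply/set0Pn; exists y; rewrite !inE.
- by have := cardsC A; lia.
- rewrite (_ : crossing (~: A) = crossing A) //.
  by apply/setP => e; apply/crossingP/crossingP => -[u [v [uA vA ve]]];
    exists v, u; rewrite finset.setUC ve; split=> //;
    move: uA vA; rewrite !inE ?negbK.
Qed.

Lemma prod_crossing (R : comRingType) (Q : V -> V -> R) (q : upair V -> R)
    (A : {set V}) :
  (forall (e : upair V) x y, val e = [set x; y]%SET -> q e = Q x y) ->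
  \prod_(e in crossing A) q e = \prod_(x in A) \prod_(y in ~: A) Q x y.
Proof.
move=> qQ; have [->|/set0Pn[x0 _]] := eqVneq A finset.set0.
  rewrite [RHS]big_set0 big_pred0 // => e; apply/negbTE/crossingP.
  by case=> x [y [+ _ _]]; rewrite inE.
(* [h] orders a crossing pair by its end in [A]; the default [x0] is never reached on such pairs. *)
pose h (e : upair V) := (odflt x0 [pick x in (val e :&: A)%SET],
                         odflt x0 [pick y in (val e :\: A)%SET]).
have hE (e : upair V) x y : x \in A -> y \notin A -> val e = [set x; y]%SET ->
    h e = (x, y).
  move=> xA yA ve; rewrite /h; congr (_, _); case: pickP => [z|/(_ _) no] /=.
  - rewrite ve !inE => /andP[/orP[] /eqP -> //].
    by rewrite (negbTE yA).
  - by have := no x; rewrite ve !inE eqxx xA.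
  - rewrite ve !inE => /andP[zA /orP[] /eqP ze //].
    by rewrite ze xA in zA.
  - by have := no y; rewrite ve !inE eqxx yA orbT.
clearbody h.
rewrite pair_big /= (reindex_omap h (fun p => insub [set p.1; p.2]%SET)) /=.
  apply: eq_big => [e|e /crossingP[x [y [xA yA ve]]]].
    apply/crossingP/idP => [[x [y [xA yA ve]]]|/andP[/andP[h1 h2] /eqP he]].
      by rewrite (hE e x y) //= xA inE yA -ve valK eqxx.
    exists (h e).1, (h e).2; split=> //; first by rewrite inE in h2.
    by case: insubP he => // u _ <- [->].
  by rewrite (hE e x y) //=; exact: qQ.
case=> x y /= /andP[xA]; rewrite inE => yA.
have xy : x != y by apply: contraNneq yA => <-.
by rewrite insubT ?cards2 ?xy // => c /=; rewrite (hE _ x y).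
Qed.

End SimpleGraph.

Local Open Scope classical_set_scope.

(** * Isolated vertices and connectivity *)

(* With [t] the reciprocal of the second-to-first moment ratio this is the
   second moment method: [2 t k - t^2 k^2 <= 1] for every [k]. *)
Lemma second_moment (R : realFieldType) (Omega : finType) (p : Omega -> R)
    (X : Omega -> nat) (t : R) : (forall w, 0 <= p w) ->
  2%:R * t * (\sum_w p w * (X w)%:R) - t ^+ 2 * (\sum_w p w * (X w)%:R ^+ 2) <=
  \sum_(w | (0 < X w)%N) p w.
Proof.
move=> p0; rewrite !mulr_sumr -sumrB [leRHS]big_mkcond; apply: ler_sum => w _.
case: ltnP => [_|]; last by rewrite leqn0 => /eqP ->; rewrite expr0n !mulr0 subrr.
have := sqr_ge0 (1 - t * (X w)%:R); have := p0 w; move: ((X w)%:R : R) (p w) => k r r0 s0.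
have : 0 <= r * (1 - t * k) ^+ 2 by rewrite mulr_ge0.
by rewrite sqrrB; nra.
Qed.

Section Degree.
Variables (R : realType) (b : nat).
Hypothesis b_gt0 : (0 < b)%N.

Lemma cut_rate1 n (x : leaf b n) :
  cut_rate R [set x]%SET = \sum_(y | y != x) rate R x y.
Proof.
by rewrite /cut_rate finset.big_set1; apply: eq_bigl => y; rewrite !inE.
Qed.

(** Passing from height [n] to [n + 1] adds [(b - 1) b^n] leaves of rate [b^(-1-2n)], that is
    [b^-n - b^-(n+1)], and the sum telescopes. *)
Lemma sum_rate n (x : leaf b n) : \sum_(y | y != x) rate R x y = 1 - b%:R ^- n.
Proof.
have bn0 : b%:R != 0 :> R by rewrite pnatr_eq0 -lt0n.
elim: n x => [|n IH] x.
  rewrite expr0 invr1 subrr; apply: big_pred0 => y.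
  by rewrite (leaf0_eq y x) eqxx.
have [g _ gK] := leaf_cons_bij b n; rewrite -(gK x); move: (g x) => [i u] /=.
rewrite big_mkcond big_leaf_cons (bigD1 i) //=.
have cons_neq (j : 'I_b) (y : leaf b n) :
    (leaf_cons j y != leaf_cons i u) = (j != i) || (y != u).
  by rewrite -negb_and.
transitivity (1 - b%:R ^- n + \sum_(j < b | j != i) b%:R^-1 * b%:R ^- n : R).
  congr (_ + _).
    rewrite -(IH u) [RHS]big_mkcond; apply: eq_bigr => y _.
    by rewrite cons_neq eqxx rate_cons // eqxx.
  apply: eq_bigr => j ji.
  transitivity (\sum_(y : leaf b n) b%:R^-1 * (b%:R ^- n * b%:R ^- n) : R).
    by apply: eq_bigr => y _; rewrite cons_neq ji rate_cons // (eq_sym i) (negbTE ji).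
  rewrite sumr_const -[LHS]mulr_natl card_leaf natrX.
  by field; rewrite bn0 expf_neq0.
rewrite sumr_const cardC1 card_ord -[X in _ + X]mulr_natl -subn1 natrB // exprS.
by field; rewrite bn0 expf_neq0.
Qed.

Lemma rate_le n (x y : leaf b n) : x != y -> rate R x y <= b%:R^-1.
Proof.
have b1 : 1 <= b%:R :> R by rewrite ler1n.
elim: n x y => [|n IH] x y.
  by case/eqP; exact: leaf0_eq.
have [g _ gK] := leaf_cons_bij b n; rewrite -(gK x) -(gK y).
move: (g x) (g y) => [i u] [j v] /= uv; rewrite rate_cons //.
case: eqP => [ij|_]; last first.
  rewrite -[leRHS]mulr1 ler_wpM2l ?invr_ge0 // -invfM invf_le1 -?exprD.
    exact: exprn_ege1.
  by rewrite exprn_gt0 // ltr0n.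
by apply: IH; apply: contra_neq uv => ->; rewrite ij.
Qed.

End Degree.

(** * Probability bounds in the Poisson edge model *)

Section LeafModel.
Variables (R : realType) (b n : nat) (lam : R).
Hypotheses (b_ge2 : (2 <= b)%N) (lam_gt0 : 0 < lam).
Variables (d : measure_display) (T : measurableType d) (P : probability T R).
Variable (N : upair (leaf b n) -> {RV P >-> nat}).
Hypothesis hN : poisson_edge_model lam N.
Let b_gt0 : (0 < b)%N := ltnW b_ge2.
Let V := leaf b n.
Let p := support_pmf N.
Let p_ge0 S : 0 <= p S := support_pmf_ge0 N S.

Lemma zero_prob_rate (e : upair V) x y : val e = [set x; y]%SET ->
  zero_prob N e = expR (- (lam * rate R x y)).
Proof.
move=> ve; have := (hN.2 e x y ve 0%N); rewrite /zero_prob /distribution /pushforward => ->.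
rewrite /poisson_pmf ifT /= ?expr0 ?fact0 ?invr1 ?mul1r //.
by rewrite mulr_gt0 // exprz_gt0 // ltr0n.
Qed.

Lemma prod_zero_prob (A : {set V}) :
  \prod_(e in crossing A) zero_prob N e = expR (- (lam * cut_rate R A)).
Proof.
rewrite (prod_crossing A zero_prob_rate) /cut_rate mulr_sumr -sumrN expR_sum.
by apply: eq_bigr => x _; rewrite mulr_sumr -sumrN expR_sum.
Qed.

Lemma prob_avoid (K : {set upair V}) :
  \sum_(S : {set upair V} | (S :&: K)%SET == finset.set0) p S =
  \prod_(e in K) zero_prob N e.
Proof.
transitivity (\sum_(S : {set upair V} | (S :&: K)%SET == finset.set0) p S * 1).
  by apply: eq_bigr => S _; rewrite mulr1.
rewrite (sum_support_cond hN.1 K (fun=> 1)) -[RHS]mulr1; congr (_ * _).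
by rewrite -[RHS](sum_support_pmf N); apply: eq_bigr => S _; rewrite mulr1.
Qed.

Let iso_prob : R := expR (- (lam * (1 - b%:R ^- n))).

Lemma prob_isolated1 (x : V) : \sum_(S | is_isolated S x) p S = iso_prob.
Proof. by rewrite prob_avoid prod_zero_prob cut_rate1 sum_rate. Qed.

(** The stars of [x] and [y] share exactly one pair, whose zero probability is counted twice in
    [iso_prob ^+ 2]. *)
Lemma prob_isolated2 (x y : V) : x != y ->
  \sum_(S | is_isolated S x && is_isolated S y) p S =
  iso_prob ^+ 2 * expR (lam * rate R x y).
Proof.
move=> xy; pose Cx := crossing [set x]%SET; pose Cy := crossing [set y]%SET.
rewrite (eq_bigl (fun S : {set upair V} => (S :&: (Cx :|: Cy))%SET == finset.set0)).
  rewrite prob_avoid.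
  have [e ve] := upair_exists xy.
  have CI : (Cy :&: Cx)%SET = [set e]%SET.
    apply/setP => e'; rewrite finset.in_setI !crossing1 [RHS]inE.
    apply/andP/eqP => [[ye xe]|->]; last by rewrite ve !inE !eqxx orbT.
    apply/val_inj/esym/eqP; rewrite finset.eqEcard (eqP (valP e')) (eqP (valP e)) leqnn.
    rewrite andbT /= ve; apply/fintype.subsetP => z; rewrite !inE.
    by case/orP => /eqP ->.
  have q1 z : \prod_(e in crossing [set z]%SET) zero_prob N e = iso_prob.
    by rewrite prod_zero_prob cut_rate1 sum_rate.
  have qy : iso_prob = expR (- (lam * rate R x y)) *
      \prod_(e in (Cy :\: Cx)%SET) zero_prob N e.
    rewrite -(q1 y) -/Cy (bigID (mem Cx)) /= -(zero_prob_rate ve); congr (_ * _).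
      rewrite (eq_bigl (fun e' => e' \in [set e]%SET)) ?finset.big_set1 // => e'.
      by rewrite -CI finset.in_setI.
    by apply: eq_bigl => e'; rewrite finset.in_setD andbC.
  rewrite (bigID (mem Cx)) /=.
  rewrite (eq_bigl (fun e => e \in Cx)); last first.
    by move=> e'; rewrite finset.in_setU; case: (e' \in Cx); rewrite ?andbF.
  rewrite q1 [X in _ * X](eq_bigl (fun e => e \in (Cy :\: Cx)%SET)); last first.
    by move=> e'; rewrite finset.in_setU finset.in_setD; case: (e' \in Cx); rewrite ?andbT.
  rewrite expr2 -mulrA; congr (_ * _); rewrite [in RHS]qy mulrAC -expRD addNr expR0.
  by rewrite mul1r.
by move=> S; rewrite finset.setIUr finset.setU_eq0.
Qed.

Let count (S : {set upair V}) := #|[set x | is_isolated S x]%SET|.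

Let countE S : (count S)%:R = \sum_x (is_isolated S x)%:R :> R.
Proof.
rewrite -natr_sum /count -sum1_card big_mkcond; congr (_%:R).
by apply: eq_bigr => x _; rewrite inE; case: is_isolated.
Qed.

Let mean : R := b%:R ^+ n * iso_prob.

Let pick_isolated (Q : pred {set upair V}) :
  \sum_S p S * (Q S)%:R = \sum_(S | Q S) p S.
Proof.
rewrite [RHS]big_mkcond; apply: eq_bigr => S _.
by case: (Q S); rewrite ?mulr1 ?mulr0.
Qed.

Let mean_count : \sum_S p S * (count S)%:R = mean.
Proof.
under eq_bigr do rewrite countE mulr_sumr.
rewrite exchange_big /=.
under eq_bigr do rewrite (pick_isolated (fun S => is_isolated S _)) prob_isolated1.
by rewrite sumr_const -[LHS]mulr_natl card_leaf natrX.
Qed.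

(** Relative excess of the second moment due to dependence: every rate is at most [1 / b], and the
    rates at a leaf add up to at most [1]. *)
Let eps : R := b%:R ^- n * lam * expR (lam / b%:R).

Let second_moment_count :
  \sum_S p S * (count S)%:R ^+ 2 <= mean + mean ^+ 2 * (1 + eps).
Proof.
have -> : \sum_S p S * (count S)%:R ^+ 2 =
    \sum_x \sum_y \sum_(S | is_isolated S x && is_isolated S y) p S.
  under eq_bigr do rewrite countE expr2 mulr_suml mulr_sumr.
  rewrite exchange_big; apply: eq_bigr => x _ /=.
  under eq_bigr do rewrite mulrA mulr_sumr.
  rewrite exchange_big; apply: eq_bigr => y _ /=.
  rewrite -(pick_isolated (fun S => is_isolated S x && is_isolated S y)).
  by apply: eq_bigr => S _; rewrite -mulrA -natrM mulnb.
have q0 : 0 <= iso_prob by exact: expR_ge0.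
have row x : \sum_y \sum_(S | is_isolated S x && is_isolated S y) p S <=
    iso_prob + iso_prob ^+ 2 * (b%:R ^+ n + lam * expR (lam / b%:R)).
  rewrite (bigD1 x) //=; apply: lerD.
    rewrite (eq_bigl (fun S => is_isolated S x)) ?prob_isolated1 // => S.
    by rewrite andbb.
  have term y : y != x ->
      \sum_(S | is_isolated S x && is_isolated S y) p S <=
      iso_prob ^+ 2 * (1 + lam * expR (lam / b%:R) * rate R x y).
    move=> yx; rewrite prob_isolated2 1?eq_sym // ler_wpM2l ?exprn_ge0 //.
    set r := rate R x y; have r0 : 0 <= r by exact: rate_ge0.
    have rb : r <= b%:R^-1 by rewrite rate_le // eq_sym.
    have E0 := expR_gt0 (lam * r).
    have : expR (lam * r) <= expR (lam / b%:R) by rewrite ler_expR ler_pM2l.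
    (* With [z = lam r] this yields [exp z <= 1 + z exp z], an excess linear in the rate, which can
       then be summed. *)
    have : 1 - lam * r <= expR (- (lam * r)) by have := expR_ge1Dx (- (lam * r)).
    rewrite expRN => h1 h2.
    have h3 : expR (lam * r) * (1 - lam * r) <= 1.
      by rewrite -ler_pdivlMl // mulr1.
    have : lam * r * expR (lam * r) <= lam * r * expR (lam / b%:R).
      by rewrite ler_wpM2l // mulr_ge0 // ltW.
    lra.
  apply: le_trans (ler_sum _ term) _; rewrite -mulr_sumr ler_wpM2l ?exprn_ge0 //.
  rewrite big_split -mulr_sumr sum_rate //= sumr_const; apply: lerD.
    by rewrite -natrX -card_leaf ler_nat max_card.
  by rewrite ler_piMr ?mulr_ge0 ?expR_ge0 ?(ltW lam_gt0) //.
apply: le_trans (ler_sum _ (fun x _ => row x)) _.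
have bn0 : b%:R ^+ n != 0 :> R by rewrite expf_neq0 // pnatr_eq0 -lt0n.
rewrite sumr_const -[leLHS]mulr_natl card_leaf natrX /mean /eps le_eqVlt.
by apply/orP; left; apply/eqP; field; rewrite bn0.
Qed.

Lemma has_isolated_vertexE w :
  has_isolated_vertex (random_multigraph N w) =
  [exists x, is_isolated (support_of N w) x].
Proof.
apply: eq_existsb => x; rewrite is_isolatedP; apply: eq_forallb => y; congr (~~ _).
by apply: eq_existsb => e; rewrite [in RHS]inE.
Qed.

Lemma mg_connectedE w :
  mg_connected (random_multigraph N w) =
  [forall x, forall y, connect (edge_rel (support_of N w)) x y].
Proof.
apply: eq_forallb => x; apply: eq_forallb => y; apply: eq_connect => u v.
by apply: eq_existsb => e; rewrite [in RHS]inE.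
Qed.

Lemma prob_has_isolated :
  P [set w | has_isolated_vertex (random_multigraph N w)] =
  (\sum_(S | [exists x : V, is_isolated S x]) support_pmf N S)%:E.
Proof.
rewrite -prob_support.
by congr (P _); apply/seteqP; split => w /=; rewrite has_isolated_vertexE.
Qed.

Lemma prob_has_isolated_le1 :
  (P [set w | has_isolated_vertex (random_multigraph N w)] <= 1)%E.
Proof.
rewrite prob_has_isolated lee_fin -(sum_support_pmf N) [leLHS]big_mkcond.
by apply: ler_sum => S _; case: ifP => // _; exact: support_pmf_ge0.
Qed.

Lemma prob_has_isolated_ge :
  ((1 + eps + mean^-1)^-1%:E <=
   P [set w | has_isolated_vertex (random_multigraph N w)])%E.
Proof.
rewrite prob_has_isolated lee_fin.
have m0 : 0 < mean.
  by rewrite mulr_gt0 ?expR_gt0 // exprn_gt0 // ltr0n.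
have e0 : 0 <= eps.
  by rewrite !mulr_ge0 ?expR_ge0 ?invr_ge0 ?exprn_ge0 // ltW.
have mV0 : 0 < mean^-1 by rewrite invr_gt0.
set D := 1 + eps + mean^-1; have D0 : 0 < D by rewrite /D; lra.
have sm : \sum_S p S * (count S)%:R ^+ 2 <= mean ^+ 2 * D.
  apply: le_trans second_moment_count _; rewrite /D le_eqVlt.
  by apply/orP; left; apply/eqP; field; rewrite lt0r_neq0.
(* This [t] is [mean] divided by the bound [mean^2 D] on the second moment, and gives [1 / D]. *)
have := @second_moment R _ p count (mean * D)^-1 p_ge0.
have count_gt0 S : (0 < count S)%N = [exists x, is_isolated S x].
  rewrite /count finset.card_gt0; apply/set0Pn/existsP => -[x]; rewrite ?inE;
  by exists x; rewrite ?inE.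
rewrite mean_count (eq_bigl _ _ count_gt0).
move=> h; apply: le_trans h.
have t0 : 0 <= (mean * D)^-1 ^+ 2 by rewrite sqr_ge0.
have := ler_wpM2l t0 sm.
have -> : (mean * D)^-1 ^+ 2 * (mean ^+ 2 * D) = D^-1.
  by field; rewrite !lt0r_neq0.
have -> : 2%:R * (mean * D)^-1 * mean = 2%:R * D^-1.
  by field; rewrite !lt0r_neq0.
lra.
Qed.

Let none_isolated (s : seq V) :
  (1 - iso_prob) ^+ size s <= \sum_(S | all (fun x => ~~ is_isolated S x) s) p S.
Proof.
have q1 : iso_prob <= 1.
  rewrite expR_le1 oppr_le0 mulr_ge0 ?(ltW lam_gt0) // subr_ge0 invf_le1.
    by rewrite exprn_ege1 // ler1n.
  by rewrite exprn_gt0 // ltr0n.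
elim: s => [|x s IH]; first by rewrite expr0 sum_support_pmf.
rewrite exprS /=; set B := fun S => all (fun y => ~~ is_isolated S y) s.
have isoD S y : is_isolated S y -> is_isolated (S :\: crossing [set x]%SET) y.
  rewrite /is_isolated -!finset.subset0; apply: fintype.subset_trans.
  by apply: finset.setSI; exact: finset.subsetDl.
(* When [x] is isolated, deleting its star does not change [S]; this brings the second sum into the
   form of [sum_support_cond]. *)
have : \sum_(S | B S) p S = \sum_(S | ~~ is_isolated S x && B S) p S +
    \sum_(S | is_isolated S x) p S * (B (S :\: crossing [set x]%SET))%:R.
  rewrite (bigID (fun S => is_isolated S x)) /= addrC; congr (_ + _).
    by apply: eq_bigl => S; rewrite andbC.
  rewrite big_mkcond [RHS]big_mkcond; apply: eq_bigr => S _.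
  case: (boolP (is_isolated S x)) => [Sx|_]; last by rewrite andbF.
  have -> : (S :\: crossing [set x])%SET = S.
    by apply/finset.setDidPl; rewrite -finset.setI_eq0.
  by rewrite andbT; case: (B S); rewrite ?mulr1 ?mulr0.
rewrite (sum_support_cond hN.1 (crossing [set x]%SET) (fun S => (B S)%:R)).
rewrite prod_zero_prob cut_rate1 sum_rate // -/iso_prob.
(* Deleting edges can only create isolated vertices, so [B] becomes less likely. *)
have : \sum_S support_pmf N S * (B (S :\: crossing [set x]%SET))%:R <= \sum_(S | B S) p S.
  rewrite [leRHS]big_mkcond; apply: ler_sum => S _.
  case: (boolP (B S)) => [_|nB]; first by rewrite ler_piMr ?p_ge0 // lern1 leq_b1.
  rewrite (_ : B _ = false) ?mulr0 //; apply: contraNF nB => /allP Bs.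
  by apply/allP => y ys; apply: contra (Bs y ys); exact: isoD.
move=> /(ler_wpM2l (expR_ge0 (- (lam * (1 - b%:R ^- n))))).
rewrite -/iso_prob => h1 h2.
have : (1 - iso_prob) * (1 - iso_prob) ^+ size s <=
    (1 - iso_prob) * \sum_(S | B S) p S by rewrite ler_wpM2l // subr_ge0.
rewrite -/(\sum_(S | ~~ is_isolated S x && B S) p S); lra.
Qed.

Lemma prob_has_isolated_le :
  (P [set w | has_isolated_vertex (random_multigraph N w)] <=
   (1 - (1 - iso_prob) ^+ (b ^ n))%:E)%E.
Proof.
rewrite prob_has_isolated lee_fin.
have := none_isolated (enum V); rewrite -cardE card_leaf.
rewrite (eq_bigl (fun S => ~~ [exists x, is_isolated S x])); last first.
  move=> S; rewrite negb_exists; apply/allP/forallP => [h x|h x _] //.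
  by apply: h; rewrite mem_enum.
have := sum_support_pmf N; rewrite (bigID (fun S => [exists x, is_isolated S x])) /=.
rewrite -/p; lra.
Qed.

(** Union bound over the small sides of cuts: a disconnected support avoids all crossing pairs of
    some nonempty small set. *)
Lemma prob_connected_ge :
  ((1 - defect b lam n 0)%:E <=
   P [set w | mg_connected (random_multigraph N w)])%E.
Proof.
pose conn (S : {set upair V}) := [forall x, forall y, connect (edge_rel S) x y].
rewrite (_ : [set w | _] = [set w | conn (support_of N w)]); last first.
  by apply/seteqP; split => w /=; rewrite mg_connectedE.
rewrite prob_support lee_fin lerBlDr.
rewrite -(sum_support_pmf N) (bigID conn) /= lerD2l /defect.
apply: (@le_trans _ _ (\sum_(A : {set V} | (A != finset.set0) && small A)
    \sum_(S : {set upair V} | (S :&: crossing A)%SET == finset.set0) p S)); last first.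
  apply: ler_sum => A _; rewrite prob_avoid prod_zero_prob /weight mul0r addr0.
  exact: lexx.
rewrite (exchange_big_dep predT) //= [leLHS]big_mkcond; apply: ler_sum => S _.
case: ifPn => [/disconnected_cut[A [A0 sA SA]]|_]; last exact: sumr_ge0.
rewrite card_leaf in sA.
rewrite (bigD1 A) /=; last by rewrite A0 SA andbT.
by rewrite lerDl; apply: sumr_ge0.
Qed.

Lemma prob_connected_le1 :
  (P [set w | mg_connected (random_multigraph N w)] <= 1)%E.
Proof.
pose conn (S : {set upair V}) := [forall x, forall y, connect (edge_rel S) x y].
rewrite (_ : [set w | _] = [set w | conn (support_of N w)]); last first.
  by apply/seteqP; split => w /=; rewrite mg_connectedE.
exact/probability_le1/(measurable_support N conn).
Qed.

End LeafModel.

(** * Limits and asymptotic estimates *)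

Lemma cvg_expRN (R : realType) (g : nat -> R) :
  g n @[n --> \oo] --> +oo -> expR (- g n) @[n --> \oo] --> (0 : R).
Proof. by move=> gy; apply: (cvg_comp g (fun x => expR (- x))) gy _; exact: cvgr_expR. Qed.

Lemma cvge_squeeze1 (R : realType) (u : nat -> R) (pr : nat -> \bar R) :
  u n @[n --> \oo] --> (0 : R) ->
  (\forall n \near \oo, ((1 - u n)%:E <= pr n <= 1)%E) ->
  pr n @[n --> \oo] --> 1%E.
Proof.
move=> u0 upr; apply: (@squeeze_cvge _ _ _ _ (fun n => (1 - u n)%:E) _ (fun=> 1%E)).
- exact: upr.
- apply: cvg_EFin; first by near=> n.
  rewrite (_ : fine \o _ = fun n => 1 - u n) // -[X in _ --> X]subr0.
  by apply: cvgB => //; exact: cvg_cst.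
- exact: cvg_cst.
Unshelve. all: by end_near. Qed.

Section Estimates.
Variables (R : realType) (b n : nat) (f : R).
Hypothesis b_ge2 : (2 <= b)%N.
Let u : R := n%:R * ln b%:R.
Let lam : R := u + f.
Hypothesis lam_gt0 : 0 < lam.

Let bR2 : 2%:R <= b%:R :> R. Proof. by rewrite ler_nat. Qed.
Let bR0 : 0 < b%:R :> R. Proof. by rewrite ltr0n ltnW. Qed.
Let bXn : b%:R ^+ n = expR u. Proof. by rewrite expRM_natl lnK // posrE. Qed.
Let u_ge0 : 0 <= u. Proof. by rewrite mulr_ge0 // ln_ge0 // ler1n ltnW. Qed.

Let mean_eq : b%:R ^+ n * expR (- (lam * (1 - b%:R ^- n))) =
  expR (lam * b%:R ^- n - f).
Proof. by rewrite {1}bXn -expRD; congr expR; rewrite /lam; ring. Qed.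

Lemma isolated_mean_ge :
  expR (- f) <= b%:R ^+ n * expR (- (lam * (1 - b%:R ^- n))).
Proof.
by rewrite mean_eq ler_expR lerDr mulr_ge0 ?(ltW lam_gt0) // invr_ge0 exprn_ge0.
Qed.

(** The mean is [exp (lam b^-n - f)], and [exp u >= 1 + u] gives [lam b^-n <= 1 + C]. *)
Lemma isolated_mean_le (C : R) : f <= C -> - f <= C ->
  b%:R ^+ n * expR (- (lam * (1 - b%:R ^- n))) <= expR (1 + 2%:R * C).
Proof.
move=> fC fNC; rewrite mean_eq ler_expR.
have C0 : 0 <= C by lra.
have : lam * b%:R ^- n <= 1 + C.
  rewrite bXn ler_pdivrMr ?expR_gt0 //.
  have := expR_ge1Dx u; rewrite /lam; have := u_ge0; nra.
lra.
Qed.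

(** Up to constants, [lam] costs [exp (u/4)] and, as [b >= 2], the exponential costs [exp (u/2)],
    against the gain [exp (- u)]. *)
Lemma second_moment_error_le (C : R) : 0 <= C -> f <= C ->
  b%:R ^- n * lam * expR (lam / b%:R) <=
  (4%:R + C) * expR (C / 2%:R) * expR (- (u / 4%:R)).
Proof.
move=> C0 fC; rewrite bXn.
have h1 : expR (lam / b%:R) <= expR (C / 2%:R) * expR (u / 2%:R).
  rewrite -expRD ler_expR -mulrDl.
  apply: (@le_trans _ _ (lam / 2%:R)); last by rewrite ler_pM2r ?invr_gt0 // /lam; lra.
  by rewrite ler_pM2l // lef_pV2 // posrE.
have h2 : lam <= (4%:R + C) * expR (u / 4%:R).
  have := expR_ge1Dx (u / 4%:R); rewrite /lam; have := u_ge0; nra.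
apply: (@le_trans _ _ ((expR u)^-1 * ((4%:R + C) * expR (u / 4%:R)) *
    (expR (C / 2%:R) * expR (u / 2%:R)))).
  by rewrite ler_pM ?mulr_ge0 ?expR_ge0 ?invr_ge0 ?(ltW lam_gt0) ?ler_wpM2l ?invr_ge0 ?expR_ge0.
rewrite -expRN le_eqVlt; apply/orP; left; apply/eqP.
have -> : - (u / 4%:R) = - u + (u / 4%:R + u / 2%:R) by field.
by rewrite !expRD; ring.
Qed.

End Estimates.

(** Since [(1 - q) (1 + 2 q) >= 1] on this range. It bounds powers of [1 - q] from below by an
    exponential. *)
Lemma expRN2_le (R : realType) (q : R) : 0 <= q <= 1 / 2%:R ->
  expR (- (2%:R * q)) <= 1 - q.
Proof.
move=> /andP[q0 q2]; have E1 := expR_ge1Dx (2%:R * q).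
rewrite expRN -[leLHS]mul1r ler_pdivrMr ?expR_gt0 //.
have : (1 - q) * (1 + 2%:R * q) <= (1 - q) * expR (2%:R * q) by rewrite ler_wpM2l; lra.
nra.
Qed.

Theorem theorem7p7 (R : realType) (b : nat) (hb : (2 <= b)%N)
    (f lambda : nat -> R)
    (hlambda : forall n, (0 < n)%N -> lambda n = n%:R * ln b%:R + f n)
    (hpos : forall n, (0 < n)%N -> 0 < lambda n)
    (d : nat -> measure_display) (T : forall n, measurableType (d n))
    (P : forall n, probability (T n) R)
    (N : forall n, upair (leaf b n) -> {RV (P n) >-> nat})
    (hN : forall n, (0 < n)%N -> poisson_edge_model (lambda n) (N n)) :
  let isolated n :=
    P n [set w | has_isolated_vertex (random_multigraph (N n) w)] in
  let connected n :=
    P n [set w | mg_connected (random_multigraph (N n) w)] in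
  (f n @[n --> \oo] --> -oo -> isolated n @[n --> \oo] --> 1%E) /\
  ((exists C : R, forall n, (0 < n)%N -> `|f n| <= C) ->
    exists2 c : R, 0 < c &
      \forall n \near \oo, (c%:E <= isolated n)%E /\
                           (isolated n <= (1 - c)%:E)%E) /\
  (forall alpha : R, b%:R - 1 < alpha ->
    (forall n, (0 < n)%N -> alpha * ln n%:R <= f n) ->
    connected n @[n --> \oo] --> 1%E).
Proof.
move=> isolated connected.
pose L : R := ln b%:R.
have bR2 : 2%:R <= b%:R :> R by rewrite ler_nat.
have L0 : 0 < L by rewrite ln_gt0 // ltr1n.
have pos n : (0 < n)%N -> 0 < n%:R * L + f n by move=> n0; rewrite -hlambda // hpos.
have model n : (0 < n)%N -> poisson_edge_model (n%:R * L + f n) (N n).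
  by move=> n0; rewrite -hlambda //; exact: hN.
have decay : expR (- (n%:R * L / 4%:R)) @[n --> \oo] --> (0 : R).
  apply: cvg_expRN; apply/cvgryPge => A; near=> n.
  rewrite ler_pdivlMr // -ler_pdivrMr //.
  by near: n; exact: nbhs_infty_ger.
(* Second moment bound shared by the first two regimes: [C = 0] when [f] tends to minus infinity,
   and a bound on [f] in the second. *)
have lower n C : (0 < n)%N -> 0 <= C -> f n <= C ->
    (((1 + (4%:R + C) * expR (C / 2%:R) * expR (- (n%:R * L / 4%:R)) + expR (f n))^-1)%:E
     <= isolated n)%E.
  move=> n0 C0 fC; apply: le_trans (prob_has_isolated_ge hb (pos n n0) (model n n0)).
  rewrite lee_fin.
  have m_ge := isolated_mean_ge hb (pos n n0).
  have e_le := second_moment_error_le hb (pos n n0) C0 fC.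
  have E0 := expR_gt0 (- f n).
  set m := _ * expR _ in m_ge *; have m0 : 0 < m by exact: lt_le_trans m_ge.
  set eps := _ * expR (_ / b%:R) in e_le *.
  have eps0 : 0 <= eps.
    by rewrite !mulr_ge0 ?expR_ge0 ?invr_ge0 ?exprn_ge0 // ltW // pos.
  have mV0 : 0 < m^-1 by rewrite invr_gt0.
  rewrite lef_pV2 ?posrE.
  - by rewrite lerD // ?lerD2l // -[f n]opprK expRN lef_pV2 ?posrE.
  - have := expR_gt0 (f n); lra.
  - lra.
split; last split.
- move=> fNy; apply: (@cvge_squeeze1 _
    (fun n => 4%:R * expR (- (n%:R * L / 4%:R)) + expR (f n))).
    rewrite -[X in _ --> X](addr0 0) -[X in _ --> X + _](mulr0 4%:R).
    apply: cvgD; first by apply: cvgM => //; exact: cvg_cst.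
    under eq_cvg do rewrite -[f _]opprK.
    by apply: cvg_expRN; exact/cvgNry.
  near=> n; have n0 : (0 < n)%N by near: n; exists 1%N.
  have f0 : f n <= 0 by near: n; move/cvgrNyPle: fNy => /(_ 0).
  rewrite (prob_has_isolated_le1 _) ?andbT.
  apply: le_trans (lower n 0 n0 (lexx 0) f0); rewrite lee_fin mul0r expR0 addr0 mulr1.
  set a := 4%:R * _; have a0 : 0 <= a by rewrite mulr_ge0 ?expR_ge0.
  have e0 := expR_ge0 (f n).
  rewrite -[leRHS]mul1r ler_pdivlMr; last by lra.
  by nra.
- case=> C fC.
  have C0 : 0 <= C by apply: le_trans (fC 1%N isT); exact: normr_ge0.
  pose M := expR (1 + 2%:R * C); have M0 : 0 < M by exact: expR_gt0.
  pose c1 := (1 + (4%:R + C) * expR (C / 2%:R) + expR C)^-1.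
  have c10 : 0 < c1.
    have := expR_gt0 C; have : 0 <= (4%:R + C) * expR (C / 2%:R).
      by rewrite mulr_ge0 ?expR_ge0 ?addr_ge0.
    by rewrite invr_gt0; lra.
  (* [c1] serves the lower bound; [M] bounds the mean, so that [(1 - q)^(b^n) >= exp (- 2 q b^n) >=
     exp (- 2 M)]. *)
  exists (Num.min c1 (expR (- (2%:R * M)))); first by rewrite lt_min c10 expR_gt0.
  near=> n; have n0 : (0 < n)%N by near: n; exists 1%N.
  have /andP[fNC fC'] : - C <= f n <= C by rewrite -ler_norml fC.
  split.
    apply: le_trans (lower n C n0 C0 fC'); rewrite lee_fin ge_min; apply/orP; left.
    have e1 : expR (- (n%:R * L / 4%:R)) <= 1.
      by rewrite expR_le1 oppr_le0 divr_ge0 // mulr_ge0 // ltW.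
    have e0 := expR_ge0 (- (n%:R * L / 4%:R)).
    have k0 : 0 <= (4%:R + C) * expR (C / 2%:R).
      by rewrite mulr_ge0 ?expR_ge0 ?addr_ge0.
    have fe : expR (f n) <= expR C by rewrite ler_expR.
    have ke := ler_piMr k0 e1; have ke0 := mulr_ge0 k0 e0.
    have := expR_gt0 (f n); have := expR_gt0 C.
    by move=> ? ?; rewrite /c1 lef_pV2 ?posrE; lra.
  apply: le_trans (prob_has_isolated_le hb (pos n n0) (model n n0)) _.
  rewrite lee_fin lerD2l lerN2 ge_min; apply/orP; right.
  set q := expR (- ((n%:R * L + f n) * _)); have q0 : 0 < q by exact: expR_gt0.
  have fNC' : - f n <= C by rewrite lerNl.
  have qM : b%:R ^+ n * q <= M := isolated_mean_le n hb fC' fNC'.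
  have bn0 : 0 < b%:R ^+ n :> R by rewrite exprn_gt0 // ltr0n ltnW.
  (* Here [q <= M / b^n], while eventually [2 M <= n < b^n]. *)
  have q2 : q <= 1 / 2%:R.
    apply: (@le_trans _ _ (M / b%:R ^+ n)); first by rewrite ler_pdivlMr // mulrC.
    rewrite ler_pdivrMr // mul1r -ler_pdivrMl ?invr_gt0 // invrK.
    apply: (@le_trans _ _ n%:R); first by near: n; exact: nbhs_infty_ger.
    by rewrite -natrX ler_nat ltnW // ltn_expl.
  apply: (@le_trans _ _ (expR (- (2%:R * q)) ^+ (b ^ n))).
    rewrite -expRM_natl ler_expR natrX mulrN lerN2 mulrCA ler_wpM2l //.
  rewrite lerXn2r ?nnegrE ?expR_ge0 ?expRN2_le //; first lra.
  by rewrite ltW.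
- move=> alpha halpha hf.
  (* As [b - 1 >= 1], the hypothesis gives [ln n <= f n], so [f] is nonnegative and tends to
     infinity. *)
  have a1 : 1 <= alpha by lra.
  have lnf n : (0 < n)%N -> ln n%:R <= f n.
    move=> n0; apply: le_trans (hf n n0).
    by rewrite ler_peMl // ln_ge0 // ler1n.
  have g0 : expR (- (f n / 4%:R)) @[n --> \oo] --> (0 : R).
    apply: cvg_expRN; apply/cvgryPge => A; near=> n.
    have n0 : (0 < n)%N by near: n; exists 1%N.
    rewrite ler_pdivlMr //; apply: le_trans (lnf n n0).
    rewrite -ler_expR lnK ?posrE ?ltr0n //.
    by near: n; exact: nbhs_infty_ger.
  apply: (@cvge_squeeze1 _ (fun n => defect_const R b * expR (- (f n / 4%:R)))).
    rewrite -[X in _ --> X](mulr0 (defect_const R b)).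
    by apply: cvgM => //; exact: cvg_cst.
  (* Provides, for large [n], the smallness condition of [defect_bound]. *)
  have sc : defect_scale R b * expR (- (f n / 4%:R)) @[n --> \oo] --> (0 : R).
    rewrite -[X in _ --> X](mulr0 (defect_scale R b)).
    by apply: cvgM => //; exact: cvg_cst.
  near=> n; have n0 : (0 < n)%N by near: n; exists 1%N.
  rewrite (prob_connected_le1 _) ?andbT.
  apply: le_trans (prob_connected_ge hb (pos n n0) (model n n0)).
  rewrite lee_fin lerD2l lerN2; apply: defect_bound => //.
  + by apply: le_trans (lnf n n0); rewrite ln_ge0 // ler1n.
  + exact: pos.
  + by near: n; apply: (@cvgr_le _ _ _ _ _ _ sc _ ltr01).
Unshelve. all: by end_near. Qed.
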